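(* For any linear Euclidean distance matrix $M\in\mathbb{R}^{n\times n}$, i.e. $M(i,j)=(a_i-a_j)^2$ for $1\le i,j\le n$ for some $a\in\mathbb{R}^n$, where $a_i\neq a_j$ for $i\neq j$, so that $M$ has rank $r=3$, we have, with $r_+=\operatorname{rank}_+(M)$, $$\operatorname{rank}_+^*(M)=n\;\le\;\max_{3\le r_u\le r_+-1}\ \min_{i=0,1}\ \operatorname{faces}(r_+,r_u-1,r_u-r+i)\;\le\;\max_{3\le r_u\le r_+-1}\operatorname{faces}(r_+,r_u-1,r_u-r)=\phi'(r,r_+)\;\le\;\binom{r_+}{\lfloor r_+/2\rfloor}\;\le\;2^{r_+}.$$
   Context: For an entrywise nonnegative matrix $M\in\mathbb{R}^{m\times n}_+$, the nonnegative rank $\operatorname{rank}_+(M)$ is the minimum $k$ such that there exist $U\in\mathbb{R}^{m\times k}_+$ and $V\in\mathbb{R}^{k\times n}_+$ with $M=UV$. The restricted nonnegative rank $\operatorname{rank}_+^*(M)$ is the minimum $k$ such that there exist $U\in\mathbb{R}^{m\times k}_+$ and $V\in\mathbb{R}^{k\times n}_+$ with $M=UV$ and $\operatorname{rank}(U)=\operatorname{rank}(M)$. $\operatorname{faces}(n,d,k)$ denotes the maximal number of $k$-faces ($k$-dimensional faces) of a polytope with $n$ vertices in dimension $d$. The function $\phi'$ is defined by $\phi'(r,r_+)=\max_{r\le r_u\le r_+-1}\operatorname{faces}(r_+,r_u-1,r_u-r)$. The maxima are over integers $r_u$.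
   Formalization: The inequality n ≤ max min faces(...) is stated only for n ≥ 4: for n = 3 one has r_+ = 3, so the range 3 ≤ r_u ≤ r_+ − 1 is empty and the maximum is undefined. All other links hold for every n ≥ 3, with an empty maximum read as 0. *)

(* Defs.v *)
(* MathComp / MathComp-Analysis; the real numbers are an arbitrary realType. *)
From mathcomp Require Import all_boot all_order all_algebra.
From mathcomp Require Import boolp classical_sets functions cardinality reals.

Set Implicit Arguments.
Unset Strict Implicit.
Unset Printing Implicit Defensive.

Import Order.TTheory GRing.Theory Num.Theory.
Local Open Scope classical_set_scope.
Local Open Scope ring_scope.

Definition nonneg_factorization (R : realType) m n k (M : 'M[R]_(m, n))
    (U : 'M[R]_(m, k)) (V : 'M[R]_(k, n)) : Prop :=
  [/\ U \is a mxOver Num.nneg, V \is a mxOver Num.nneg & M = U *m V].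

(* The two sets below are nonempty for nonnegative M (take U := M and V := 1),
   so their infima in nat are minima; on other matrices rank_plus and
   rank_plus_star return the default value 0. *)
Definition rank_plus (R : realType) m n (M : 'M[R]_(m, n)) : nat :=
  infimum 0%N [set k : nat | exists (U : 'M[R]_(m, k)) (V : 'M[R]_(k, n)),
    nonneg_factorization M U V].

Definition rank_plus_star (R : realType) m n (M : 'M[R]_(m, n)) : nat :=
  infimum 0%N [set k : nat | exists (U : 'M[R]_(m, k)) (V : 'M[R]_(k, n)),
    nonneg_factorization M U V /\ \rank U = \rank M].

Definition linear_edm (R : realType) n (a : 'I_n -> R) : 'M[R]_n :=
  \matrix_(i < n, j < n) (a i - a j) ^+ 2.

(* Convex hull of the rows of A. *)
Definition conv_rows (R : realType) N d (A : 'M[R]_(N, d)) : set 'rV[R]_d :=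
  [set x | exists w : 'rV[R]_N,
    [/\ w \is a mxOver Num.nneg, \sum_i w ord0 i = 1 & x = w *m A]].

Definition polytope (R : realType) d (P : set 'rV[R]_d) : Prop :=
  exists (N : nat) (A : 'M[R]_(N, d)), P = conv_rows A.

(* x0 + V is the affine hull of X. In particular the empty set has no affine
   dimension. *)
Definition has_aff_dim (R : realType) d (X : set 'rV[R]_d) (k : nat) : Prop :=
  exists (x0 : 'rV[R]_d) (V : {vspace 'rV[R]_d}),
    [/\ X x0,
        forall x, X x -> x - x0 \in V,
        forall W : {vspace 'rV[R]_d},
          (forall x, X x -> x - x0 \in W) -> (V <= W)%VS
      & \dim V = k].

(* Nonempty faces: the set of points of P where a linear form c attains an
   upper bound b valid on P. The choice c = 0, b = 0 gives P itself. *)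
Definition face (R : realType) d (P F : set 'rV[R]_d) : Prop :=
  F !=set0 /\
  exists (c : 'cV[R]_d) (b : R),
    (forall x, P x -> (x *m c) ord0 ord0 <= b) /\
    F = [set x | P x /\ (x *m c) ord0 ord0 = b].

Definition kfaces (R : realType) d (P : set 'rV[R]_d) (k : nat) :
    set (set 'rV[R]_d) :=
  [set F | face P F /\ has_aff_dim F k].

(* Maximal number of k-faces of a d-dimensional polytope with n vertices; the
   vertices are the 0-faces. The supremum is 0 if there is no such polytope. *)
Definition faces (R : realType) (n d k : nat) : nat :=
  supremum 0%N [set m : nat | exists P : set 'rV[R]_d,
    [/\ polytope P, has_aff_dim P d,
        (kfaces P 0 #= `I_n)%card & (kfaces P k #= `I_m)%card]].

(* The range is r <= ru <= rp - 1. *)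
Definition phi' (R : realType) (r rp : nat) : nat :=
  \max_(r <= ru < rp) faces R rp (ru - 1) (ru - r).

(* Main.v *)
(* Let U, V be a nonnegative factorization of M of minimal size N, U having
   columns of sum 1.  These columns are then the N vertices of a polytope T of
   dimension rank U - 1.  If rank U = N then V has rank 3 and M = V^T U^T is a
   restricted factorization, so N = n and U := M, V := 1 can be used instead;
   hence rank U < N may be assumed.

   The rows of U are affine functions that are nonnegative on T, hence
   nonnegative combinations of the facet functions of T: U = L E with one row of
   E per facet.  Then M = L (E V), and E V has rank 3, so that the transposed
   factorization is restricted and T has at least rank_plus_star M = n facets.
   A ridge lies in at most two facets and a facet of a polytope of dimension at
   least 2 contains at least two ridges, so T also has at least n ridges; no
   generic plane section is needed.

   The upper bound comes from mapping a k-face to k + 1 affinely independent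
   vertices of it, which determine the face. *)
Require Import Defs.
From mathcomp Require Import all_boot all_order all_algebra.
From mathcomp Require Import boolp classical_sets functions cardinality reals.
From mathcomp Require Import ring lra zify.

Set Implicit Arguments.
Unset Strict Implicit.
Unset Printing Implicit Defensive.

Section Development.
Import fintype boot.finset Order.TTheory GRing.Theory Num.Theory.
Local Open Scope ring_scope.

(** * Nonnegative vectors of a row space *)

Lemma nnegmxP (R : numDomainType) m n (M : 'M[R]_(m, n)) :
  reflect (forall i j, 0 <= M i j) (M \is a mxOver Num.nneg).
Proof. by apply: (iffP mxOverP) => h i j; have := h i j; rewrite nnegrE. Qed.

(* Induction on the set T of sign constraints: if the solution y for T without t
   has y_t < 0, apply the induction hypothesis to the vectors of Y vanishing at t;
   the dual solution z thus obtained must satisfy z_t >= 0, as z y = 0. *)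
Lemma farkas (R : realFieldType) D N (Y : 'M[R]_(D, N)) (j : 'I_N)
    (T : {set 'I_N}) : j \notin T ->
  (exists y : 'rV_N, [/\ (y <= Y)%MS, 0 < y 0 j &
     forall l, l \in T -> 0 <= y 0 l]) \/
  (exists z : 'cV_N, [/\ Y *m z = 0, 0 < z j 0,
     forall l, l \in T -> 0 <= z l 0 &
     forall l, l != j -> l \notin T -> z l 0 = 0]).
Proof.
elim: {T}_.+1 {-2}T (ltnSn #|T|) D Y => // m IHm T.
rewrite ltnS => leTm D Y jT; have [-> | [t tT]] := set_0Vmem T.
  have [col0 | /forallPn[i yi]] := boolP [forall i, Y i j == 0].
    right; exists (delta_mx j 0); split.
    - apply/matrixP=> i k; rewrite ord1 -colE !mxE; exact/eqP/(forallP col0).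
    - by rewrite !mxE !eqxx ltr01.
    - by move=> l; rewrite inE.
    - by move=> l /negPf nlj _; rewrite !mxE nlj.
  left; exists ((Y i j)^-1 *: row i Y); split.
  - by rewrite scalemx_sub ?row_sub.
  - by rewrite !mxE mulVf ?ltr01.
  - by move=> l; rewrite inE.
have ltT : (#|T :\ t| < m)%N by rewrite (cardsD1 t) tT in leTm.
have jTt : j \notin T :\ t by rewrite inE negb_and jT orbT.
have tj : t != j by apply: contraNneq jT => <-.
have [[y [yY yj yT]] | [z [Yz zj zT z0]]] := IHm _ ltT _ Y jTt; last first.
  right; exists z; split=> // l.
    move=> lT; have [-> | nlt] := eqVneq l t; last by apply: zT; rewrite !inE nlt.
    by rewrite z0 // !inE eqxx.
  by move=> lj lT; rewrite z0 // !inE negb_and lT orbT.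
have [yt | yt] := leP 0 (y 0 t).
  left; exists y; split=> // l lT; have [-> // | nlt] := eqVneq l t.
  by apply: yT; rewrite !inE nlt.
set y1 := (y 0 t)^-1 *: y.
have y1t : y1 0 t = 1 by rewrite mxE mulVf // lt_eqF.
pose Y' := Y - col t Y *m y1.
have Y'Y : (Y' <= Y)%MS.
  by rewrite addmx_sub // eqmx_opp (submx_trans (submxMl _ _)) // scalemx_sub.
have Y't i : Y' i t = 0 by rewrite !mxE big_ord1 !mxE -/y1 mulVf ?mulr1 ?subrr ?lt_eqF.
have [[x [xY xj xT]] | [z [Yz zj zT z0]]] := IHm _ ltT _ Y' jTt.
  left; exists x; split=> //; first exact: submx_trans xY Y'Y.
  move=> l lT; have [-> | nlt] := eqVneq l t; last by apply: xT; rewrite !inE nlt.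
  have /submxP[u ->] := xY; rewrite mxE big1 // => i _.
  by rewrite Y't mulr0.
right; pose c := (y1 *m z) 0 0.
pose x := z - c *: delta_mx t 0.
have Yx : Y *m x = 0.
  rewrite mulmxBr -scalemxAr -colE; apply/eqP; rewrite subr_eq0 -subr_eq0.
  move: Yz; rewrite mulmxBl -mulmxA [y1 *m z]mx11_scalar mul_mx_scalar => ->.
  by [].
have xj : 0 < x j 0 by rewrite !mxE eq_sym (negPf tj) mulr0 subr0.
have xT l : l \in T :\ t -> 0 <= x l 0.
  by move=> /[dup] lT; rewrite 2!inE !mxE => /andP[/negPf-> _]; rewrite mulr0 subr0 zT.
have x0 l : l != j -> l \notin T -> x l 0 = 0.
  move=> lj lT; have /negPf nlt : l != t by apply: contraNneq lT => ->.
  by rewrite !mxE nlt mulr0 subr0 z0 // !inE nlt.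
exists x; split=> // l lT.
have [-> | nlt] := eqVneq l t; last by apply: xT; rewrite !inE nlt.
rewrite leNgt; apply/negP => xt.
have : (y *m x) 0 0 = 0 by have /submxP[u ->] := yY; rewrite -mulmxA Yx mulmx0 mxE.
apply/eqP; rewrite gt_eqF // mxE (bigD1 t) //= ltr_wpDr ?nmulr_rgt0 //.
apply: sumr_ge0 => i nit.
have [iT | niT] := boolP (i \in T).
  by rewrite mulr_ge0 ?yT ?xT // !inE nit.
have [-> | nij] := eqVneq i j; first by rewrite mulr_ge0 // ltW.
by rewrite x0 // mulr0.
Qed.

Definition zeros (R : realFieldType) N (y : 'rV[R]_N) : {set 'I_N} :=
  [set i | y 0 i == 0].

(** Columns outside S are zeroed and not deleted, so that restrictions to different sets keep one
    size and compose. *)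
Definition restr_mx (R : realFieldType) N (S : {set 'I_N}) : 'M[R]_N :=
  diag_mx (\row_i (i \in S)%:R).

Arguments restr_mx {R N} S.

Definition vanish (R : realFieldType) D N (Y : 'M[R]_(D, N)) S : 'M[R]_N :=
  (Y :&: kermx (restr_mx S))%MS.

(* The zero sets of the nonnegative vectors of the row space of Y, sorted by the
   rank of the columns of Y they select.  For Y := col_mx 1 A^T they are the
   index sets of the faces of the convex hull of the rows of A, those of rank
   k + 1 giving the faces of dimension k. *)
Definition fsets (R : realFieldType) D N (Y : 'M[R]_(D, N)) (k : nat) :
    {set {set 'I_N}} :=
  [set S | `[< exists y : 'rV_N, [/\ (y <= Y)%MS, y \is a mxOver Num.nneg,
                 S = zeros y & \rank (Y *m restr_mx S) = k] >]].

Lemma fsetsP (R : realFieldType) D N (Y : 'M[R]_(D, N)) k S :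
  S \in fsets Y k -> exists y : 'rV_N, [/\ (y <= Y)%MS,
    y \is a mxOver Num.nneg, S = zeros y & \rank (Y *m restr_mx S) = k].
Proof. by rewrite inE => /asboolP. Qed.

Lemma mul_restr_mxE (R : realFieldType) m N (Y : 'M[R]_(m, N)) S i j :
  (Y *m restr_mx S) i j = Y i j * (j \in S)%:R.
Proof. by rewrite mul_mx_diag !mxE. Qed.

Lemma mul_restr_mxI (R : realFieldType) m N (Y : 'M[R]_(m, N)) S T :
  Y *m restr_mx S *m restr_mx T = Y *m restr_mx (S :&: T).
Proof. by apply/matrixP=> i j; rewrite !mul_restr_mxE inE -mulrA -natrM mulnb. Qed.

Lemma mul_restr_mx_eq0 (R : realFieldType) N (y : 'rV[R]_N) S :
  (y *m restr_mx S == 0) = (S \subset zeros y).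
Proof.
apply/eqP/subsetP => [y0 i iS | Sy].
  by have /rowP/(_ i) := y0; rewrite mul_restr_mxE mxE iS mulr1 inE => ->.
apply/rowP=> i; rewrite mul_restr_mxE mxE.
by have [/Sy | _] := boolP (i \in S); rewrite ?mulr0 // inE => /eqP->; rewrite mul0r.
Qed.

Lemma sub_vanish (R : realFieldType) D N (Y : 'M[R]_(D, N)) S (y : 'rV_N) :
  (y <= vanish Y S)%MS = (y <= Y)%MS && (S \subset zeros y).
Proof. by rewrite sub_capmx -mul_restr_mx_eq0; congr (_ && _); apply/sub_kermxP/eqP. Qed.

Lemma rank_vanish (R : realFieldType) D N (Y : 'M[R]_(D, N)) S :
  (\rank (vanish Y S) + \rank (Y *m restr_mx S))%N = \rank Y.
Proof. by rewrite addnC mxrank_mul_ker. Qed.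

Lemma rank_restr_leq (R : realFieldType) D N (Y : 'M[R]_(D, N)) (S T : {set 'I_N}) :
  S \subset T -> (\rank (Y *m restr_mx S) <= \rank (Y *m restr_mx T))%N.
Proof. by move=> /setIidPr<-; rewrite -mul_restr_mxI mxrankM_maxl. Qed.

(** [vanish Y T] lies in [vanish Y S], and equal ranks on S and T give both the same dimension by
    [rank_vanish]; hence they coincide. *)
Lemma vanish_superset (R : realFieldType) D N (Y : 'M[R]_(D, N)) (S T : {set 'I_N})
    (y : 'rV_N) : S \subset T ->
  \rank (Y *m restr_mx S) = \rank (Y *m restr_mx T) ->
  (y <= Y)%MS -> S \subset zeros y -> T \subset zeros y.
Proof.
move=> ST eqr yY Sy.
have TS : (vanish Y T <= vanish Y S)%MS.
  apply/row_subP => i; have := row_sub i (vanish Y T).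
  by rewrite !sub_vanish => /andP[-> /(subset_trans ST)].
have ST' : (vanish Y S <= vanish Y T)%MS.
  rewrite -(geq_leqif (mxrank_leqif_sup TS)).
  by have := rank_vanish Y S; have := rank_vanish Y T; lia.
have : (y <= vanish Y S)%MS by rewrite sub_vanish yY.
by move=> /submx_trans/(_ ST'); rewrite sub_vanish => /andP[].
Qed.

(* If y is not on an extreme ray, some g in Y vanishes where y does without being a
   multiple of y.  Then g - s y and y - t (g - s y), for extremal s and t, are
   nonnegative and vanish at more places than y. *)
Lemma ray_decomposition (R : realFieldType) D N (Y : 'M[R]_(D, N)) p
    (E : {set 'I_N} -> 'rV[R]_N) : \rank Y = p.+1 ->
  (forall S, S \in fsets Y p ->
     [/\ (E S <= Y)%MS, E S \is a mxOver Num.nneg & S = zeros (E S)]) ->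
  forall y : 'rV_N, (y <= Y)%MS -> y \is a mxOver Num.nneg ->
  exists c : {set 'I_N} -> R,
    (forall S, 0 <= c S) /\ y = \sum_(S in fsets Y p) c S *: E S.
Proof.
move=> rY EY y; have [m] := ubnP #|~: zeros y|.
elim: m y => // m IHm y; rewrite ltnS => lem yY /[dup] /nnegmxP y0 yn.
have [-> | ynz] := eqVneq y 0.
  by exists (fun=> 0); split=> //; rewrite big1 // => S _; rewrite scale0r.
have yV : (y <= vanish Y (zeros y))%MS by rewrite sub_vanish yY /=.
(* If y spans the vectors of Y vanishing on its zeros, then [zeros y] has rank p and y is a positive
   multiple of [E (zeros y)]. *)
have [Vy | /row_subPn[k gNy]] := boolP (vanish Y (zeros y) <= y)%MS.
  have rV : \rank (vanish Y (zeros y)) = 1%N.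
    have : (0 < \rank (vanish Y (zeros y)))%N.
      by rewrite lt0n mxrank_eq0; apply: contraNneq ynz => V0; rewrite -submx0 -V0.
    by have := leq_trans (mxrankS Vy) (rank_leq_row y); lia.
  have Sy : zeros y \in fsets Y p.
    rewrite inE; apply/asboolP; exists y; split=> //.
    by have := rank_vanish Y (zeros y); rewrite rV rY; lia.
  have [EYy En Ez] := EY _ Sy.
  have : (E (zeros y) <= vanish Y (zeros y))%MS by rewrite sub_vanish EYy -Ez /=.
  move=> /submx_trans/(_ Vy)/sub_rVP[a Ea].
  have [i yi] : exists i, y 0 i != 0.
    by apply/existsP; apply: contraNT ynz => /existsPn h;
      apply/eqP/rowP=> i; rewrite mxE; apply/eqP/negPn/h.
  have Ei : E (zeros y) 0 i != 0.
    apply: contraNneq yi => Ei; have : i \in zeros y by rewrite Ez inE Ei.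
    by rewrite inE.
  have a0 : 0 < a.
    have: 0 < E (zeros y) 0 i by rewrite lt_neqAle eq_sym Ei; apply/(nnegmxP _ En).
    by rewrite Ea mxE pmulr_lgt0 // lt_neqAle eq_sym yi y0.
  exists (fun S => if S == zeros y then a^-1 else 0); split.
    by move=> S; case: ifP => // _; rewrite invr_ge0 ltW.
  rewrite (bigD1 (zeros y)) //= eqxx big1 ?addr0 => [|S /andP[_ /negPf->]];
    last by rewrite scale0r.
  by rewrite Ea scalerA mulVf ?scale1r ?gt_eqF.
set g := row k _ in gNy.
have /andP[gY yg] : (g <= Y)%MS && (zeros y \subset zeros g) by rewrite -sub_vanish row_sub.
have [i0 yi0] : exists i, i \notin zeros y.
  by apply/existsP; apply: contraNT ynz => /existsPn h;
    apply/eqP/rowP=> i; rewrite mxE; apply/eqP; have := h i; rewrite inE negbK.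
have ypos i : i \notin zeros y -> 0 < y 0 i by rewrite inE => h; rewrite lt_neqAle eq_sym h y0.
have [i1 yi1 min1] := arg_minP (P := fun i => i \notin zeros y) (fun i => g 0 i / y 0 i) yi0.
pose s := g 0 i1 / y 0 i1.
pose g' := g - s *: y.
have g'Y : (g' <= Y)%MS by rewrite addmx_sub // eqmx_opp scalemx_sub.
have g'E i : g' 0 i = g 0 i - s * y 0 i by rewrite !mxE.
have yg' i : i \in zeros y -> g' 0 i = 0.
  move=> /[dup] /(subsetP yg); rewrite !inE g'E => /eqP-> /eqP->.
  by rewrite mulr0 subr0.
have g'0 i : 0 <= g' 0 i.
  have [/yg'-> // | iy] := boolP (i \in zeros y).
  by rewrite g'E subr_ge0 -ler_pdivlMr ?ypos //; apply: min1.
have g'n : g' \is a mxOver Num.nneg by apply/nnegmxP => i j; rewrite ord1.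
have g'i1 : g' 0 i1 = 0 by rewrite g'E /s divfK ?subrr // gt_eqF ?ypos.
have lt_zeros (x : 'rV[R]_N) i : zeros y \subset zeros x -> i \notin zeros y -> x 0 i = 0 ->
    (#|~: zeros x| < m)%N.
  move=> yx iy xi; apply: leq_trans lem; rewrite proper_card // properC properE yx /=.
  by apply/subsetPn; exists i; rewrite // inE xi.
have [c [c0 cE]] : exists c : {set 'I_N} -> R,
    (forall S, 0 <= c S) /\ g' = \sum_(S in fsets Y p) c S *: E S.
  apply: IHm => //; apply: (lt_zeros _ i1) => //.
  by apply/subsetP => i iy; rewrite inE yg'.
have [i2 gi2] : exists i, g' 0 i != 0.
  apply/existsP; apply: contraNT gNy => /existsPn h.
  suff -> : g = s *: y by rewrite scalemx_sub.
  apply/rowP=> i; have /eqP := negbNE (h i).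
  by rewrite g'E => /eqP; rewrite subr_eq0 [RHS]mxE => /eqP.
have [i3 gi3 min3] := arg_minP (P := fun i => g' 0 i != 0) (fun i => y 0 i / g' 0 i) gi2.
have gpos i : g' 0 i != 0 -> 0 < g' 0 i by move=> h; rewrite lt_neqAle eq_sym h g'0.
pose t := y 0 i3 / g' 0 i3.
have t0 : 0 <= t by rewrite divr_ge0.
pose y' := y - t *: g'.
have y'E i : y' 0 i = y 0 i - t * g' 0 i by rewrite !mxE.
have yy' i : i \in zeros y -> y' 0 i = 0.
  move=> /[dup] /yg' gi; rewrite inE => /eqP yi.
  by rewrite y'E gi yi mulr0 subr0.
have [c' [c'0 c'E]] : exists c : {set 'I_N} -> R,
    (forall S, 0 <= c S) /\ y' = \sum_(S in fsets Y p) c S *: E S.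
  apply: IHm.
  - apply: (lt_zeros _ i3).
    + by apply/subsetP => i iy; rewrite inE yy'.
    + by apply: contraNN gi3 => /yg'->.
    + by rewrite y'E /t divfK ?subrr.
  - by rewrite addmx_sub // eqmx_opp scalemx_sub.
  - apply/nnegmxP => i j; rewrite ord1 y'E subr_ge0.
    have [-> | gj] := eqVneq (g' 0 j) 0; first by rewrite mulr0.
    by rewrite -ler_pdivlMr ?gpos //; apply: min3.
exists (fun S => c' S + t * c S); split=> [S|].
  by apply: addr_ge0 => //; apply: mulr_ge0.
have -> : y = y' + t *: g' by rewrite subrK.
rewrite cE c'E scaler_sumr -big_split /=; apply: eq_bigr => S _.
by rewrite scalerDl scalerA.
Qed.

(** * Facets and ridges *)

Lemma restr_mxT (R : realFieldType) m N (Y : 'M[R]_(m, N)) : Y *m restr_mx setT = Y.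
Proof. by apply/matrixP=> i j; rewrite mul_restr_mxE inE mulr1. Qed.

(** By [rank_vanish] the vectors of Y vanishing on a facet form a line, and y spans it. *)
Lemma facet_ray (R : realFieldType) D N (Y : 'M[R]_(D, N)) p (x y : 'rV_N) :
  \rank Y = p.+1 -> \rank (Y *m restr_mx (zeros y)) = p -> (y <= Y)%MS ->
  (x <= Y)%MS -> zeros y \subset zeros x -> (x <= y)%MS.
Proof.
move=> rY ry yY xY yx.
have ynz : y != 0.
  apply: contra_eq_neq ry => y0.
  have -> : zeros y = setT by apply/setP=> i; rewrite !inE y0 mxE eqxx.
  by rewrite restr_mxT rY gtn_eqF.
have yV : (y <= vanish Y (zeros y))%MS by rewrite sub_vanish yY /=.
have Vy : (vanish Y (zeros y) <= y)%MS.
  rewrite -(geq_leqif (mxrank_leqif_sup yV)) rank_rV ynz.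
  by have := rank_vanish Y (zeros y); lia.
by apply: submx_trans Vy; rewrite sub_vanish xY.
Qed.

(** By [facet_ray] the function of T is a multiple of that of S. The factor is nonzero, since the
    zero set of the zero vector has rank p + 1. *)
Lemma facet_antichain (R : realFieldType) D N (Y : 'M[R]_(D, N)) p S T :
  \rank Y = p.+1 -> S \in fsets Y p -> T \in fsets Y p -> S \subset T -> S = T.
Proof.
move=> rY /fsetsP[y [yY yn -> ry]] /fsetsP[x [xY xn -> rx]] yx.
have /sub_rVP[a xE] := facet_ray rY ry yY xY yx.
have an : a != 0.
  apply: contra_eq_neq rx => a0; rewrite xE a0 scale0r.
  have -> : zeros (0 : 'rV[R]_N) = setT by apply/setP=> i; rewrite !inE mxE eqxx.
  by rewrite restr_mxT rY gtn_eqF.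
by apply/setP=> i; rewrite !inE xE mxE mulf_eq0 (negPf an).
Qed.

Lemma ray_factorization (R : realFieldType) D N (Y : 'M[R]_(D, N)) p m
    (U : 'M_(m, N)) : \rank Y = p.+1 -> (U <= Y)%MS -> U \is a mxOver Num.nneg ->
  exists (L : 'M_(m, #|fsets Y p|)) (E : 'M_(#|fsets Y p|, N)),
  [/\ L \is a mxOver Num.nneg, E \is a mxOver Num.nneg, (E <= Y)%MS & U = L *m E].
Proof.
move=> rY UY /nnegmxP Un.
have EX S : exists y : 'rV_N, S \in fsets Y p ->
    [/\ (y <= Y)%MS, y \is a mxOver Num.nneg & S = zeros y].
  have [/fsetsP[y [yY yn Sy _]] | SY] := boolP (S \in fsets Y p); first by exists y.
  by exists 0.
have [E EP] := choice EX.
have cX i : exists c : {set 'I_N} -> R,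
    (forall S, 0 <= c S) /\ row i U = \sum_(S in fsets Y p) c S *: E S.
  apply: (ray_decomposition rY EP); first exact: submx_trans (row_sub i U) UY.
  by apply/nnegmxP=> k j; rewrite mxE.
have [c cP] := choice cX.
exists (\matrix_(i, k) c i (enum_val k)), (\matrix_k E (enum_val k)); split.
- by apply/nnegmxP=> i k; rewrite mxE; case: (cP i).
- apply/nnegmxP=> k j; rewrite mxE.
  by have [_ /nnegmxP h _] := EP _ (enum_valP k); apply: h.
- by apply/row_subP=> k; rewrite rowK; case: (EP _ (enum_valP k)).
- apply/row_matrixP=> i; case: (cP i) => _ ->.
  rewrite row_mul mulmx_sum_row big_enum_val /=; apply: eq_bigr => k _.
  by rewrite rowK !mxE.
Qed.

Lemma dominate (R : realFieldType) N (e x : 'rV[R]_N) : e \is a mxOver Num.nneg ->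
  exists2 t : R, 0 <= t & forall i, e 0 i != 0 -> 0 < x 0 i + t * e 0 i.
Proof.
(* The quotients at zeros of e are 0 by the convention for division; the 1 makes the bound
   strict. *)
move=> /nnegmxP e0; exists (1 + \sum_i `|x 0 i| / e 0 i).
  by rewrite addr_ge0 // sumr_ge0 // => i _; rewrite divr_ge0.
move=> i ei; have ep : 0 < e 0 i by rewrite lt_neqAle eq_sym ei e0.
have : `|x 0 i| / e 0 i < 1 + \sum_i `|x 0 i| / e 0 i.
  rewrite (bigD1 i) //= addrCA ltrDl ltr_pwDl // sumr_ge0 // => j _.
  by rewrite divr_ge0.
rewrite ltr_pdivrMr // => /(le_lt_trans _) lt_x.
by rewrite -ltrBlDl sub0r lt_x // -normrN ler_norm.
Qed.

(** Adding large multiples of e to the rows of Y makes them nonnegative, hence combinations of the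
    facet functions, whose span thus contains Y. The condition on [zeros e] stands in for
    positivity, so that Y may also be a matrix restricted to a facet. *)
Lemma rank_le_card_facets (R : realFieldType) D N (Y : 'M[R]_(D, N)) p (e : 'rV_N) :
  \rank Y = p.+1 -> (e <= Y)%MS -> e \is a mxOver Num.nneg ->
  (forall y : 'rV_N, (y <= Y)%MS -> zeros e \subset zeros y) ->
  (p < #|fsets Y p|)%N.
Proof.
move=> rY eY en ze.
have tX k : exists t, 0 <= t /\ forall i, e 0 i != 0 -> 0 < Y k i + t * e 0 i.
  by have [t t0 h] := dominate (row k Y) en; exists t; split=> // i /h; rewrite mxE.
have [t tP] := choice tX.
pose U := Y + (\col_k t k) *m e.
have UY : (U <= Y)%MS by rewrite addmx_sub // (submx_trans (submxMl _ _)).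
have Un : U \is a mxOver Num.nneg.
  apply/nnegmxP=> k i; rewrite !mxE big_ord1 mxE.
  have [ei | /(proj2 (tP k))/ltW//] := eqVneq (e 0 i) 0.
  have : i \in zeros (row k Y) by apply: (subsetP (ze _ (row_sub k Y))); rewrite inE ei.
  by rewrite inE mxE => /eqP->; rewrite ei mulr0 addr0.
(* Stacking e below U lets the added multiples of e be subtracted again within the row space of
   E. *)
have [|| L [E [_ _ _ UE]]] := @ray_factorization _ _ _ Y p _ (col_mx U e) rY.
- by rewrite col_mx_sub UY.
- by apply/nnegmxP=> k i; rewrite mxE; case: split => k'; apply/nnegmxP.
have : (col_mx U e <= E)%MS by rewrite UE submxMl.
rewrite col_mx_sub => /andP[UsE esE].
have : (U - (\col_k t k) *m e <= E)%MS.
  by rewrite addmx_sub // eqmx_opp (submx_trans (submxMl _ _)).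
rewrite addrK => YE.
by rewrite -rY (leq_trans (mxrankS YE)) ?rank_leq_row.
Qed.

(** By [rank_vanish] the functions vanishing on a ridge form a plane, and the nonnegative ones among
    them a cone with at most two extreme rays. *)
Lemma facets_above_ridge (R : realFieldType) D N (Y : 'M[R]_(D, N)) p S :
  \rank Y = p.+2 -> S \in fsets Y p ->
  (#|[set F in fsets Y p.+1 | S \subset F]| <= 2)%N.
Proof.
move=> rY /fsetsP[_ [_ _ _ rS]]; rewrite leqNgt; apply/negP.
move=> /card_gt2P[F1 [F2 [F3 [[]]]]].
rewrite !inE => /andP[/asboolP[y1 [y1Y y1n E1 r1]] S1].
move=> /andP[/asboolP[y2 [y2Y y2n E2 r2]] S2].
move=> /andP[/asboolP[y3 [y3Y y3n E3 r3]] S3] [F12 F23 F31].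
have anti x y : (x <= Y)%MS -> x \is a mxOver Num.nneg ->
    \rank (Y *m restr_mx (zeros x)) = p.+1 -> (y <= Y)%MS ->
    y \is a mxOver Num.nneg -> \rank (Y *m restr_mx (zeros y)) = p.+1 ->
    zeros x \subset zeros y -> zeros x = zeros y.
  by move=> xY xn rx yY yn ry; apply: (facet_antichain rY);
    rewrite inE; apply/asboolP; [exists x | exists y].
have y1nz : y1 != 0.
  apply: contra_eq_neq r1 => y0.
  have -> : F1 = setT by apply/setP=> i; rewrite E1 !inE y0 mxE eqxx.
  by rewrite restr_mxT rY gtn_eqF.
have y2nz : y2 != 0.
  apply: contra_eq_neq r2 => y0.
  have -> : F2 = setT by apply/setP=> i; rewrite E2 !inE y0 mxE eqxx.
  by rewrite restr_mxT rY gtn_eqF.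
subst F1 F2 F3.
have n12 : ~~ (y1 <= y2)%MS.
  apply: contraNN F12 => /sub_rVP[a y1E]; rewrite eq_sym; apply/eqP/anti=> //.
  by apply/subsetP=> i; rewrite !inE y1E mxE => /eqP->; rewrite mulr0.
have V12 : (vanish Y S <= col_mx y1 y2)%MS.
  have sub : (col_mx y1 y2 <= vanish Y S)%MS by rewrite col_mx_sub !sub_vanish y1Y y2Y S1 S2.
  rewrite -(geq_leqif (mxrank_leqif_sup sub)).
  have rV : \rank (vanish Y S) = 2%N.
    by have := rank_vanish Y S; rewrite rS rY -(add2n p) => /addIn.
  rewrite rV -addsmxE; have : (y2 < y1 + y2)%MS.
    by rewrite ltmxE addsmxSr /= addsmx_sub (negPf n12).
  by move/rank_ltmx; rewrite rank_rV y2nz.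
have : (y3 <= vanish Y S)%MS by rewrite sub_vanish y3Y.
move=> /submx_trans/(_ V12)/submxP[u]; rewrite -[u]hsubmxK mul_row_col.
rewrite [lsubmx u]mx11_scalar [rsubmx u]mx11_scalar !mul_scalar_mx.
set b := lsubmx u 0 0; set c := rsubmx u 0 0 => y3E.
have y3c i : y3 0 i = b * y1 0 i + c * y2 0 i by rewrite y3E !mxE.
(* A third facet function would be y3 = b y1 + c y2 with b, c >= 0, and then its
   zeros would be among those of y1 or y2. *)
have cone_ge0 x y d : (x <= Y)%MS -> x \is a mxOver Num.nneg ->
    \rank (Y *m restr_mx (zeros x)) = p.+1 -> (y <= Y)%MS ->
    y \is a mxOver Num.nneg -> \rank (Y *m restr_mx (zeros y)) = p.+1 ->
    zeros x != zeros y -> (forall i, y 0 i = 0 -> y3 0 i = d * x 0 i) -> 0 <= d.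
  move=> xY xn rx yY yn ry xy y3d.
  have /subsetPn[i] : ~~ (zeros y \subset zeros x).
    by apply: contraNN xy => yx; rewrite eq_sym; apply/eqP/anti.
  rewrite !inE => /eqP/y3d y3i xi.
  have xp : 0 < x 0 i by rewrite lt_neqAle eq_sym xi; apply/nnegmxP.
  by rewrite -(pmulr_lge0 _ xp) -y3i; apply/nnegmxP.
have b0 : 0 <= b.
  by apply: (cone_ge0 y1 y2) => // i y2i; rewrite y3c y2i mulr0 addr0.
have c0 : 0 <= c.
  by apply: (cone_ge0 y2 y1) => //; rewrite 1?eq_sym // => i y1i; rewrite y3c y1i mulr0 add0r.
have [bz | bnz] := eqVneq b 0.
  case/eqP: F23; apply: anti => //; apply/subsetP=> i.
  by rewrite !inE y3c bz => /eqP->; rewrite mul0r mulr0 addr0.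
case/eqP: F31; apply: anti => //; apply/subsetP=> i; rewrite !inE y3c.
have y10 : 0 <= y1 0 i by apply/nnegmxP.
have y20 : 0 <= y2 0 i by apply/nnegmxP.
by rewrite paddr_eq0 ?mulr_ge0 // mulf_eq0 (negPf bnz) => /andP[].
Qed.

(** The facets of F are counted by [rank_le_card_facets] for Y restricted to F, and each of them
    yields a ridge of Y. *)
Lemma ridges_below_facet (R : realFieldType) D N (Y : 'M[R]_(D, N)) p (e : 'rV_N) F :
  \rank Y = p.+2 -> (e <= Y)%MS -> (forall i, 0 < e 0 i) -> F \in fsets Y p.+1 ->
  (p < #|[set S in fsets Y p | S \subset F]|)%N.
Proof.
move=> rY eY e0 /fsetsP[y [yY yn FE rF]].
have F_sub (x : 'rV_N) : (x <= Y *m restr_mx F)%MS -> ~: F \subset zeros x.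
  move=> /submxP[u ->]; apply/subsetP=> i; rewrite !inE => /negPf iF.
  by rewrite mulmxA mul_restr_mxE iF mulr0.
have eE i : (e *m restr_mx F) 0 i = e 0 i * (i \in F)%:R by rewrite mul_restr_mxE.
have ze x : (x <= Y *m restr_mx F)%MS -> zeros (e *m restr_mx F) \subset zeros x.
  move=> /F_sub Fx; apply: subset_trans Fx; apply/subsetP=> i.
  by rewrite !inE eE mulf_eq0 gt_eqF //= pnatr_eq0 eqb0.
have en : e *m restr_mx F \is a mxOver Num.nneg.
  by apply/nnegmxP=> k i; rewrite ord1 eE mulr_ge0 ?ler0n // ltW.
apply: leq_trans (rank_le_card_facets rF (submxMr _ eY) en ze) _.
have sF : {in fsets (Y *m restr_mx F) p, forall Z : {set 'I_N}, ~: F \subset Z}.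
  by move=> Z /fsetsP[x [xY _ -> _]]; apply: F_sub.
(* Z contains the complement of F, where all restricted vectors vanish, so its trace on F determines
   it. *)
rewrite -(@card_in_imset _ _ (fun Z : {set 'I_N} => F :&: Z)); last first.
  move=> Z1 Z2 /sF/subsetP s1 /sF/subsetP s2 /setP eqZ; apply/setP=> i.
  have := eqZ i; rewrite !inE; have [//|iF _] := boolP (i \in F).
  by rewrite s1 ?s2 // inE.
apply/subset_leq_card/subsetP=> _ /imsetP[Z /fsetsP[x [xY xn ZE rZ]] ->].
rewrite mul_restr_mxI in rZ.
rewrite inE subsetIl andbT inE; apply/asboolP.
(* x agrees on F with a vector v of Y. Adding a large multiple of y, which is zero on F and positive
   elsewhere, makes v positive outside F and leaves it unchanged on F. *)
have /submxP[u xE] := xY; pose v := u *m Y.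
have [t t0 tP] := dominate v yn.
have xv i : i \in F -> x 0 i = v 0 i.
  by move=> iF; rewrite xE mulmxA mul_restr_mxE iF mulr1.
have yF i : i \in F -> y 0 i = 0 by rewrite FE inE => /eqP.
have wE i : (v + t *: y) 0 i = v 0 i + t * y 0 i by rewrite !mxE.
exists (v + t *: y); split=> //.
- by rewrite addmx_sub ?submxMl ?scalemx_sub.
- apply/nnegmxP=> k i; rewrite ord1 wE.
  have [iF | iF] := boolP (i \in F); first by rewrite yF // mulr0 addr0 -xv //; apply/nnegmxP.
  by apply/ltW/tP; move: iF; rewrite FE inE.
- apply/setP=> i; rewrite inE [RHS]inE wE.
  have [iF | iF] := boolP (i \in F); first by rewrite yF // mulr0 addr0 -xv // ZE inE.
  by rewrite gt_eqF //; apply: tP; move: iF; rewrite FE inE.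
Qed.

(** Double counting of incidences; [0 < p] gives each facet at least two ridges. *)
Lemma card_facets_le_ridges (R : realFieldType) D N (Y : 'M[R]_(D, N)) p (e : 'rV_N) :
  (0 < p)%N -> \rank Y = p.+2 -> (e <= Y)%MS -> (forall i, 0 < e 0 i) ->
  (#|fsets Y p.+1| <= #|fsets Y p|)%N.
Proof.
move=> p0 rY eY e0.
have : (\sum_(F in fsets Y p.+1) 2 <= \sum_(S in fsets Y p) 2)%N.
  pose inc := (\sum_(F in fsets Y p.+1) \sum_(S in fsets Y p) (S \subset F))%N.
  apply: (@leq_trans inc).
    apply: leq_sum => F FY; have := ridges_below_facet rY eY e0 FY.
    by rewrite -sum1dep_card -big_mkcondr /= => /(leq_trans _) ->.
  rewrite /inc exchange_big /=; apply: leq_sum => S SY.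
  by have := facets_above_ridge rY SY; rewrite -sum1dep_card -big_mkcondr.
by rewrite !sum_nat_const; lia.
Qed.

(** * Upper bounds on the number of faces *)

(** The columns picked by [maxrankfun] are independent, hence nonzero, hence indexed by S. *)
Lemma rank_basis (R : realFieldType) D N (Y : 'M[R]_(D, N)) (S : {set 'I_N}) :
  exists T : {set 'I_N}, [/\ T \subset S, #|T| = \rank (Y *m restr_mx S) &
    \rank (Y *m restr_mx T) = \rank (Y *m restr_mx S)].
Proof.
pose A := (Y *m restr_mx S)^T; pose f := maxrankfun A.
have fS i : f i \in S.
  apply: contraT => /negPf fiS; have : ~~ row_free (rowsub f A).
    apply/row_freePn; exists i; suff -> : row i (rowsub f A) = 0 by rewrite sub0mx.
    by apply/rowP=> j; rewrite mxE mxE mxE mul_restr_mxE fiS mulr0 mxE.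
  by rewrite maxrowsub_free.
have TS : [set f i | i : 'I_(\rank A)] \subset S.
  by apply/subsetP=> _ /imsetP[i _ ->].
exists [set f i | i : 'I_(\rank A)]; split=> //.
  by rewrite card_imset ?card_ord ?mxrank_tr //; apply: maxrankfun_inj.
apply/eqP; rewrite eqn_leq rank_restr_leq //=.
have -> : \rank (Y *m restr_mx S) = \rank (rowsub f A) by rewrite (eq_maxrowsub A) mxrank_tr.
rewrite -[leqRHS]mxrank_tr; apply/mxrankS/row_subP=> i.
suff -> : row i (rowsub f A) = row (f i) (Y *m restr_mx [set f i | i : 'I_(\rank A)])^T.
  exact: row_sub.
apply/rowP=> j; do 3!rewrite [LHS]mxE; do 2!rewrite [RHS]mxE; rewrite !mul_restr_mxE fS.
by rewrite (_ : f i \in _ = true) //; apply/imsetP; exists i.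
Qed.

(** A basis of the columns in S has k elements and determines S: by [vanish_superset], a vector of Y
    vanishing on it vanishes on S. *)
Lemma card_fsets_le (R : realFieldType) D N (Y : 'M[R]_(D, N)) k :
  (#|fsets Y k| <= 'C(N, k))%N.
Proof.
have [f fP] := choice (rank_basis Y).
rewrite -[N in 'C(N, k)]card_ord -card_draws -(@card_in_imset _ _ f).
  apply/subset_leq_card/subsetP=> _ /imsetP[S /fsetsP[y [_ _ _ rS]] ->].
  by rewrite inE; case: (fP S) => _ -> _; rewrite rS.
move=> S T /fsetsP[y [yY _ SE rS]] /fsetsP[x [xY _ TE rT]] fST.
have [[fS _ rfS] [fT _ rfT]] := (fP S, fP T).
apply/eqP; rewrite eqEsubset; apply/andP; split.
  by rewrite TE; apply: (vanish_superset fS rfS xY); rewrite fST -TE.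
have : T \subset zeros y by apply: (vanish_superset fT rfT yY); rewrite -fST -SE.
by rewrite -SE.
Qed.

Lemma bin_le_half n k : ('C(n, k) <= 'C(n, n./2))%N.
Proof.
have up m : (m < n./2)%N -> ('C(n, m) <= 'C(n, m.+1))%N.
  move=> lt_m; rewrite -(leq_pmul2l (ltn0Sn m)) mul_bin_left leq_mul2r.
  by apply/orP; right; lia.
have lo m : (m <= n./2 -> 'C(n, m) <= 'C(n, n./2))%N.
  move=> le_m; have [j] : exists j, n./2 = (m + j)%N by exists (n./2 - m)%N; lia.
  elim: j m le_m => [|j IHj] m le_m eq_h; first by rewrite eq_h addn0.
  by apply: leq_trans (up m _) (IHj _ _ _); lia.
have [/lo// | gt_k] := leqP k n./2.
have [/bin_small -> // | le_k] := ltnP n k.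
by rewrite -bin_sub // lo //; lia.
Qed.

Lemma bin_le_exp2 n k : ('C(n, k) <= 2 ^ n)%N.
Proof.
rewrite -[n in 'C(n, k)]card_ord -card_draws (leq_trans (max_card _)) //.
by rewrite -cardsT -powersetT card_powerset cardsT card_ord.
Qed.

(** * Faces of a polytope in homogeneous coordinates *)

Lemma has_aff_dim_uniq (R : realType) d (X : set 'rV[R]_d) k l :
  has_aff_dim X k -> has_aff_dim X l -> k = l.
Proof.
move=> [x [V [Xx XV Vmin <-]]] [y [W [Xy XW Wmin <-]]].
suff -> : V = W by [].
apply/eqP; rewrite eqEsubv; apply/andP; split; [apply: Vmin | apply: Wmin] => z Xz.
  have -> : z - x = (z - y) - (x - y) by rewrite opprB addrA subrK.
  by rewrite rpredB ?XW.
have -> : z - y = (z - x) - (y - x) by rewrite opprB addrA subrK.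
by rewrite rpredB ?XV.
Qed.

Lemma mx_vspaceP (R : realFieldType) m d (G : 'M[R]_(m, d)) :
  exists2 V : {vspace 'rV[R]_d},
    (forall v : 'rV_d, (v \in V) = (v <= G)%MS) & \dim V = \rank G.
Proof.
pose B := row_base G; pose X := [tuple row i B | i < \rank G].
have XE (i : 'I_(\rank G)) : X`_i = row i B by rewrite -tnth_nth tnth_mktuple.
have sumX (k : 'I_(\rank G) -> R) : \sum_i k i *: X`_i = (\row_i k i) *m B.
  by rewrite mulmx_sum_row; apply: eq_bigr => i _; rewrite XE mxE.
have Xfree : free X.
  apply/freeP=> k; rewrite sumX => kB i.
  have /rowP/(_ i) : \row_i k i = 0.
    by apply: (row_free_inj (row_base_free G)); rewrite -/B kB mul0mx.
  by rewrite !mxE.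
exists <<X>>%VS; last by rewrite (eqP Xfree) size_tuple.
move=> v; apply/idP/idP => [/coord_span-> | ].
  by rewrite sumX (submx_trans (submxMl _ _)) ?eq_row_base.
rewrite -(eq_row_base G) => /submxP[u ->]; rewrite mulmx_sum_row.
by apply: rpred_sum => i _; rewrite rpredZ // -XE memv_span // mem_nth // size_tuple.
Qed.

(* The column i of homog A is the point row i A of the polytope, in homogeneous
   coordinates: the row space of homog A consists of the vectors of values of the
   affine functions at the rows of A. *)
Definition homog (R : realFieldType) N d (A : 'M[R]_(N, d)) : 'M_(1 + d, N) :=
  col_mx (const_mx 1) A^T.

(** The faces of [conv_rows A] have this form, S being the zero set of an affine function that is
    nonnegative on the rows of A. *)
Definition hull (R : realType) N d (A : 'M[R]_(N, d)) (S : {set 'I_N}) :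
    set 'rV[R]_d :=
  [set x | exists w : 'rV[R]_N, [/\ w \is a mxOver Num.nneg,
    \sum_i w ord0 i = 1, forall i, i \notin S -> w ord0 i = 0 & x = w *m A]]%classic.

Lemma row_hull (R : realType) N d (A : 'M[R]_(N, d)) (S : {set 'I_N}) i :
  i \in S -> hull A S (row i A).
Proof.
move=> iS; exists (delta_mx 0 i); split; last by rewrite rowE.
- by apply/nnegmxP=> k j; rewrite mxE; case: andP => _; rewrite ?ler01.
- rewrite (bigD1 i) //= mxE !eqxx big1 ?addr0 // => j /negPf ji.
  by rewrite mxE ji andbF.
- by move=> j; rewrite mxE andbC; case: eqVneq => // ->; rewrite iS.
Qed.

Lemma hull_conv (R : realType) N d (A : 'M[R]_(N, d)) S x : hull A S x -> conv_rows A x.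
Proof. by move=> [w [wn w1 _ xE]]; exists w. Qed.

(** u is an affine function with constant term [lsubmx u] and linear part [rsubmx u]; averaging its
    values at the rows of A with weights w gives its value at [w *m A]. *)
Lemma mul_homog_tr (R : realType) N d (A : 'M[R]_(N, d)) (u : 'rV_(1 + d)) (w : 'rV_N) :
  \sum_i w ord0 i = 1 ->
  \sum_i (u *m homog A) 0 i * w 0 i =
    lsubmx u 0 0 + (w *m A *m (rsubmx u)^T) 0 0.
Proof.
move=> w1; have -> : \sum_i (u *m homog A) 0 i * w 0 i = (u *m homog A *m w^T) 0 0.
  by rewrite mxE; apply: eq_bigr => i _; rewrite [w^T _ _]mxE.
rewrite -mulmxA mul_col_mx -{1}[u]hsubmxK mul_row_col mxE; congr (_ + _).
  rewrite mxE big_ord1 [X in _ * X](_ : _ = 1) ?mulr1 // mxE -[RHS]w1.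
  by apply: eq_bigr => i _; rewrite !mxE mul1r.
by rewrite -trmx_mul -[rsubmx u in LHS]trmxK -trmx_mul mxE.
Qed.

Lemma mul_homog_row (R : realType) N d (A : 'M[R]_(N, d)) (u : 'rV_(1 + d)) i :
  (u *m homog A) 0 i = lsubmx u 0 0 + (row i A *m (rsubmx u)^T) 0 0.
Proof.
have sum_delta (f : 'I_N -> R) : \sum_j f j * (delta_mx 0 i : 'rV[R]_N) 0 j = f i.
  rewrite (bigD1 i) //= mxE !eqxx mulr1 big1 ?addr0 // => j /negPf ji.
  by rewrite mxE ji andbF mulr0.
rewrite rowE -mul_homog_tr ?sum_delta //.
by rewrite -[RHS](sum_delta (fun=> 1)); apply: eq_bigr => j _; rewrite mul1r.
Qed.

(** A weighted sum of nonnegative values is zero exactly when the weights are supported on the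
    zeros. *)
Lemma homog_zerosP (R : realType) N d (A : 'M[R]_(N, d)) (u : 'rV_(1 + d)) x :
  u *m homog A \is a mxOver Num.nneg -> conv_rows A x ->
  0 <= lsubmx u 0 0 + (x *m (rsubmx u)^T) 0 0 /\
  (lsubmx u 0 0 + (x *m (rsubmx u)^T) 0 0 = 0 <-> hull A (zeros (u *m homog A)) x).
Proof.
move=> /nnegmxP yn [w [wn w1 ->]]; have /nnegmxP w0 := wn.
have yw i : 0 <= (u *m homog A) 0 i * w 0 i by rewrite mulr_ge0.
split; first by rewrite -mul_homog_tr ?sumr_ge0.
split=> [|[v [_ v1 vz ->]]].
  rewrite -mul_homog_tr // => /eqP; rewrite psumr_eq0 // => /allP h.
  exists w; split=> // i; rewrite inE => yi; have := h i; rewrite mem_index_enum.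
  by move=> /(_ isT); rewrite mulf_eq0 (negPf yi) => /eqP.
rewrite -mul_homog_tr // big1 // => i _.
have [|/vz->] := boolP (i \in zeros (u *m homog A)); last by rewrite mulr0.
by rewrite inE => /eqP->; rewrite mul0r.
Qed.

(** Recovers the index set of a face from the face, which makes [hull] injective on zero sets. *)
Lemma mem_hull (R : realType) N d (A : 'M[R]_(N, d)) (y : 'rV_N) i :
  (y <= homog A)%MS -> y \is a mxOver Num.nneg ->
  hull A (zeros y) (row i A) <-> i \in zeros y.
Proof.
move=> /submxP[u ->] un; split=> [h|]; last exact: row_hull.
have [_ [_ /(_ h)]] := homog_zerosP un (hull_conv h).
by rewrite -mul_homog_row inE => ->.
Qed.

(** A linear form c bounded by b is the same as a nonnegative affine function b - c, and the bound
    is attained at its zeros. The index i expresses that the face is nonempty. *)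
Lemma faceP (R : realType) N d (A : 'M[R]_(N, d)) (F : set 'rV[R]_d) :
  face (conv_rows A) F <-> exists (y : 'rV_N) (i : 'I_N),
    [/\ (y <= homog A)%MS, y \is a mxOver Num.nneg, i \in zeros y &
        F = hull A (zeros y)].
Proof.
split=> [[[x Fx] [c [b [cb FE]]]] | [y [i [/submxP[u yE] yn iy ->]]]].
  pose u : 'rV_(1 + d) := row_mx b%:M (- c^T).
  have uE z : lsubmx u 0 0 + (z *m (rsubmx u)^T) 0 0 = b - (z *m c) 0 0.
    by rewrite row_mxKl row_mxKr linearN /= trmxK mulmxN !mxE eqxx mulr1n.
  have un : u *m homog A \is a mxOver Num.nneg.
    apply/nnegmxP=> k i; rewrite ord1 mul_homog_row uE subr_ge0; apply: cb.
    exact: hull_conv (row_hull A (set11 i)).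
  have FH : F = hull A (zeros (u *m homog A)).
    rewrite FE; apply/seteqP; split=> z /=.
      move=> [Pz zb]; have [_ [+ _]] := homog_zerosP un Pz; apply.
      by rewrite uE zb subrr.
    move=> hz; have Pz := hull_conv hz; split=> //.
    have [_ [_ /(_ hz)]] := homog_zerosP un Pz.
    by rewrite uE => /eqP; rewrite subr_eq0 => /eqP.
  have [w [_ w1 wz _]] : hull A (zeros (u *m homog A)) x by rewrite -FH.
  have [i iz] : exists i, i \in zeros (u *m homog A).
    apply/existsP; apply: contra_eqT w1 => /existsPn h.
    have -> : \sum_i w ord0 i = 0 by apply: big1 => i _; apply: wz; apply: h.
    by rewrite eq_sym oner_neq0.
  by exists (u *m homog A), i; split=> //; apply: submxMl.
rewrite yE in yn iy *; split; first by exists (row i A); apply: row_hull.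
exists (- (rsubmx u)^T), (lsubmx u 0 0).
have cE z : (z *m - (rsubmx u)^T) 0 0 = - (z *m (rsubmx u)^T) 0 0.
  by rewrite mulmxN mxE.
split=> [z Pz|].
  by have [+ _] := homog_zerosP yn Pz; rewrite cE; lra.
apply/seteqP; split=> z /=.
  move=> hz; have Pz := hull_conv hz; split=> //.
  by have [_ [_ /(_ hz)]] := homog_zerosP yn Pz; rewrite cE; lra.
move=> [Pz zE]; have [_ [+ _]] := homog_zerosP yn Pz; apply.
by move: zE; rewrite cE; lra.
Qed.

(** Subtracting the homogeneous row of i0 from the others leaves that row and the differences in G,
    now with leading entry 0. G spans the direction space, whence the shift by one between dimension
    and rank. *)
Lemma hull_aff_dim (R : realType) N d (A : 'M[R]_(N, d)) (S : {set 'I_N}) i0 k :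
  i0 \in S ->
  has_aff_dim (hull A S) k <-> \rank (homog A *m restr_mx S) = k.+1.
Proof.
move=> i0S.
pose G := \matrix_(i < N) ((i \in S)%:R *: (row i A - row i0 A)).
have rkG : \rank (homog A *m restr_mx S) = (\rank G).+1.
  rewrite -mxrank_tr; set B := (_ *m _)^T.
  have rowB i : row i B = (i \in S)%:R *: (row_mx (const_mx 1 : 'M_1) (row i A)).
    apply/rowP=> j; rewrite mxE [B _ _]mxE mul_restr_mxE !mxE mulrC.
    by case: split => j'; rewrite !mxE.
  have BE : (B :=: block_mx (const_mx 1 : 'M_1) (row i0 A) 0 G)%MS.
    apply/eqmxP/andP; split.
      apply/row_subP=> i; rewrite rowB.
      have [iS|_] := boolP (i \in S); last by rewrite scale0r sub0mx.
      have -> : row_mx (const_mx 1 : 'M_1) (row i A) =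
          row_mx (const_mx 1) (row i0 A) + row_mx 0 (row i G).
        by rewrite add_row_mx addr0 rowK iS scale1r subrKC.
      rewrite scale1r addmx_sub //.
        by rewrite /block_mx -addsmxE addsmxSl.
      apply: (submx_trans _ (_ : (row_mx 0 G <= _)%MS));
        last by rewrite /block_mx -addsmxE addsmxSr.
      apply/submxP; exists (delta_mx 0 i).
      by rewrite mul_mx_row mulmx0 -rowE.
    rewrite /block_mx col_mx_sub; apply/andP; split.
      by have := row_sub i0 B; rewrite rowB i0S scale1r.
    apply/row_subP=> i; rewrite row_row_mx row0 rowK.
    have [iS|_] := boolP (i \in S); last by rewrite scale0r row_mx0 sub0mx.
    have -> : row_mx 0 (true%:R *: (row i A - row i0 A)) = row i B - row i0 B.
      by rewrite !rowB iS i0S !scale1r opp_row_mx add_row_mx subrr.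
    by rewrite addmx_sub ?eqmx_opp ?row_sub.
  rewrite BE.
  (* The right factor is unitriangular, so the rank is that of the block diagonal, one more than the
     rank of G. *)
  have -> : block_mx (const_mx 1 : 'M_1) (row i0 A) 0 G =
      block_mx (1%:M : 'M_1) 0 0 G *m block_mx 1%:M (row i0 A) 0 1%:M.
    rewrite mulmx_block !mul1mx !mulmx1 !mul0mx !mulmx0 !addr0 add0r.
    by congr block_mx; apply/matrixP=> i j; rewrite !ord1 !mxE eqxx.
  rewrite mxrankMfree ?rank_diag_block_mx ?mxrank1 //.
  by rewrite row_free_unit unitmxE det_ublock !det1 mulr1 unitr1.
have [V VP dV] := mx_vspaceP G.
have hV : has_aff_dim (hull A S) (\rank G).
  exists (row i0 A), V; split=> //.
  - exact: row_hull.
  - move=> _ [w [_ w1 wz ->]]; rewrite VP; apply/submxP; exists w.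
    rewrite [w *m G]mulmx_sum_row mulmx_sum_row.
    rewrite -[X in _ - X]scale1r -w1 scaler_suml -sumrB; apply: eq_bigr => i _.
    rewrite rowK; have [iS|/wz->] := boolP (i \in S); last by rewrite !scale0r subrr.
    by rewrite scale1r scalerBr.
  - move=> W WP; apply/subvP=> v; rewrite VP => /submxP[u ->].
    rewrite mulmx_sum_row; apply: rpred_sum => i _; rewrite rpredZ // rowK.
    have [iS|_] := boolP (i \in S); last by rewrite scale0r mem0v.
    by rewrite scale1r WP //; apply: row_hull.
rewrite rkG; split=> [/(has_aff_dim_uniq hV)->//|[<-]//].
Qed.

Lemma fsets_gt0 (R : realFieldType) D N (Y : 'M[R]_(D, N)) k (S : {set 'I_N}) :
  \rank (Y *m restr_mx S) = k.+1 -> exists i, i \in S.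
Proof.
move=> rS; apply/existsP; apply: contra_eqT rS => /existsPn h.
suff -> : Y *m restr_mx S = 0 by rewrite mxrank0.
by apply/matrixP=> i j; rewrite mul_restr_mxE (negPf (h j)) mulr0 mxE.
Qed.

Lemma kfacesE (R : realType) N d (A : 'M[R]_(N, d)) k :
  kfaces (conv_rows A) k =
    (hull A @` [set S | S \in fsets (homog A) k.+1])%classic.
Proof.
apply/seteqP; split=> F /=.
  move=> [/faceP[y [i [yA yn iy ->]]] /(hull_aff_dim _ _ iy) rS].
  by exists (zeros y) => //=; rewrite inE; apply/asboolP; exists y.
move=> [S /fsetsP[y [yA yn SE rS]] <-]; have [i iS] := fsets_gt0 rS.
split; last by apply/(hull_aff_dim _ _ iS).
by apply/faceP; exists y, i; rewrite -SE.
Qed.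

Lemma card_finset_II (T : finType) (F : {set T}) :
  ([set x | x \in F]%classic #= `I_#|F|)%card.
Proof.
have -> : [set x | x \in F]%classic = (@enum_val _ (mem F) @` classical_sets.setT)%classic.
  apply/seteqP; split=> x /= => [xF | [i _ <-]]; last exact: enum_valP.
  by exists (enum_rank_in xF x) => //; rewrite enum_rankK_in.
apply: card_eq_trans (inj_card_eq _) _; first by move=> i j _ _; apply: enum_val_inj.
by rewrite card_eq_sym card_II.
Qed.

Lemma card_kfaces (R : realType) N d (A : 'M[R]_(N, d)) k m :
  (kfaces (conv_rows A) k #= `I_m)%card <-> m = #|fsets (homog A) k.+1|.
Proof.
have kE : (kfaces (conv_rows A) k #= `I_#|fsets (homog A) k.+1|)%card.
  rewrite kfacesE; apply: card_eq_trans (inj_card_eq _) (card_finset_II _).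
  move=> S T; rewrite !classical_sets.in_setE /=.
  move=> /fsetsP[y [yA yn SE _]] /fsetsP[x [xA xn TE _]] hST.
  apply/setP=> i; apply/idP/idP; rewrite SE TE in hST *.
    by move/(mem_hull _ yA yn); rewrite hST => /(mem_hull _ xA xn).
  by move/(mem_hull _ xA xn); rewrite -hST => /(mem_hull _ yA yn).
split=> [km | -> //]; apply/card_eq_II; rewrite card_eq_sym in km.
exact: card_eq_trans km kE.
Qed.

Lemma supremum_nat_le (A : set nat) b :
  (forall m, A m -> (m <= b)%N) ->
  (supremum 0%N A <= b)%N /\ forall m, A m -> (m <= supremum 0%N A)%N.
Proof.
move=> Ab; have [->|/set0P[m0 Am0]] := eqVneq A classical_sets.set0.
  by rewrite supremum0.
have exA : exists m, `[< A m >] by exists m0; apply/asboolP.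
have bA m : `[< A m >] -> (m <= b)%N by move=> /asboolP/Ab.
have [m /asboolP Am mA] := ex_maxnP exA bA.
have : supremums A (supremum 0%N A).
  rewrite /supremum ifF; last by apply/negbTE/set0P; exists m0.
  apply: (@xgetPex _ 0%N); exists m; split=> [k Ak|k]; last exact.
  by apply: mA; apply/asboolP.
by move=> [ubA lbA]; split=> [|k /ubA//]; apply: lbA => k /Ab.
Qed.

Lemma infimum_nat (A : set nat) m : A m ->
  A (infimum 0%N A) /\ (infimum 0%N A <= m)%N.
Proof.
move=> Am; have exA : exists m, `[< A m >] by exists m; apply/asboolP.
have [k /asboolP Ak kA] := ex_minnP exA.
have : infimums A (infimum 0%N A).
  rewrite /infimum ifF; last by apply/negbTE/set0P; exists m.
  apply: (@xgetPex _ 0%N); exists k; split=> [l Al|l]; last exact.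
  by apply: kA; apply/asboolP.
move=> [lbA ubA]; split; last exact: lbA.
suff -> : infimum 0%N A = k by [].
apply/eqP; rewrite eqn_leq; apply/andP; split; first exact: lbA.
by apply: ubA => l Al; apply: kA; apply/asboolP.
Qed.

(** * Vertices and irredundant families of points *)

(** For [B := (homog A)^T] the entries 1 force the weights to sum to 1, so that no point is a convex
    combination of the others, repetitions included. For [B := U^T], taking w = 0 shows that U has
    no zero column. *)
Definition irredundant (R : realFieldType) N D (B : 'M[R]_(N, D)) : Prop :=
  forall i (w : 'rV_N), w \is a mxOver Num.nneg -> w 0 i = 0 -> row i B <> w *m B.

(** The weight that V puts on row i is redistributed to the other rows according to w. *)
Lemma redundant_row (R : realFieldType) n N D (V : 'M[R]_(n, N.+1))
    (B : 'M_(N.+1, D)) i (w : 'rV_N.+1) :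
  V \is a mxOver Num.nneg -> w \is a mxOver Num.nneg -> w 0 i = 0 ->
  row i B = w *m B ->
  exists2 W : 'M_(n, N), W \is a mxOver Num.nneg & V *m B = W *m row' i B.
Proof.
move=> /nnegmxP V0 /nnegmxP w0 wi Bi.
pose V' := V + col i V *m (w - delta_mx 0 i).
have V'E k j : V' k j = V k j + V k i * (w 0 j - (j == i)%:R).
  by rewrite !mxE big_ord1 !mxE eqxx.
exists (col' i V').
  apply/nnegmxP=> k j; rewrite mxE V'E eq_sym (negPf (neq_lift i j)) subr0.
  by rewrite addr_ge0 ?mulr_ge0.
have -> : V *m B = V' *m B by rewrite mulmxDl -mulmxA mulmxBl -rowE Bi subrr mulmx0 addr0.
apply/matrixP=> k j; rewrite !mxE (bigD1_ord i) //= V'E eqxx wi sub0r mulrN1 subrr mul0r add0r.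
by apply: eq_bigr => l _; rewrite !mxE.
Qed.

(* Y' consists of the vectors y - y_i 1, which vanish at i; a dual solution of
   Farkas' lemma for Y' would write row i of Y^T as a convex combination of the
   other rows. *)
Lemma exposed_vertex (R : realFieldType) D N (Y : 'M[R]_(D, N)) (i : 'I_N) :
  ((const_mx 1 : 'rV_N) <= Y)%MS -> irredundant Y^T ->
  exists y : 'rV_N, [/\ (y <= Y)%MS, y \is a mxOver Num.nneg & zeros y = [set i]].
Proof.
move=> eY Yirr; pose Y' := Y - col i Y *m const_mx 1.
have Y'Y : (Y' <= Y)%MS by rewrite addmx_sub // eqmx_opp (submx_trans (submxMl _ _)).
have Y'i k : Y' k i = 0 by rewrite !mxE big_ord1 !mxE mulr1 subrr.
have yX j : exists y : 'rV_N, [/\ (y <= Y)%MS, y \is a mxOver Num.nneg,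
    y 0 i = 0 & j != i -> 0 < y 0 j].
  have [-> | ji] := eqVneq j i.
    by exists 0; split; rewrite ?sub0mx ?mxE //; apply/nnegmxP=> k l; rewrite mxE.
  have jT : j \notin ~: [set i; j] by rewrite !inE eqxx orbT.
  have [[y [yY yj yT]] | [z [Yz zj zT z0]]] := farkas Y' jT.
    have yi : y 0 i = 0.
      by have /submxP[u ->] := yY; rewrite mxE big1 // => k _; rewrite Y'i mulr0.
    exists y; split=> //; first exact: submx_trans Y'Y.
    apply/nnegmxP=> k l; rewrite ord1; have [-> | li] := eqVneq l i; first by rewrite yi.
    have [-> | lj] := eqVneq l j; first exact: ltW.
    by apply: yT; rewrite !inE negb_or li lj.
  have zn l : 0 <= z l 0.
    have [-> | lj] := eqVneq l j; first exact: ltW.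
    have [lT | lT] := boolP (l \in ~: [set i; j]); first exact: zT.
    by rewrite z0.
  pose s := \sum_l z l 0.
  have s0 : 0 < s.
    by rewrite /s (bigD1 j) //= ltr_pwDl // sumr_ge0.
  case: (Yirr i (s^-1 *: z^T)).
  - by apply/nnegmxP=> k l; rewrite !mxE ord1 mulr_ge0 // invr_ge0 ltW.
  - rewrite !mxE z0 ?mulr0 //; first by rewrite eq_sym.
    by rewrite !inE eqxx.
  - have /eqP := Yz; rewrite mulmxBl subr_eq0 -mulmxA => /eqP YzE.
    rewrite -scalemxAl -trmx_mul YzE -tr_col.
    have -> : const_mx 1 *m z = s%:M.
      by rewrite [LHS]mx11_scalar mxE; congr (_%:M); apply: eq_bigr => l _; rewrite mxE mul1r.
    by rewrite mul_mx_scalar linearZ /= scalerA mulVf ?scale1r ?gt_eqF.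
have [y yP] := choice yX.
have sE k : (\sum_(j | j != i) y j) 0 k = \sum_(j | j != i) y j 0 k by rewrite summxE.
have y0 j k : 0 <= y j 0 k by have [_ /nnegmxP h _ _] := yP j; apply: h.
exists (\sum_(j | j != i) y j); split.
- by apply: summx_sub => j _; case: (yP j).
- by apply/nnegmxP=> k l; rewrite ord1 sE sumr_ge0.
- apply/setP=> k; rewrite !inE sE; have [-> | ki] := eqVneq k i.
    by rewrite big1 ?eqxx // => j _; case: (yP j).
  rewrite gt_eqF // (bigD1 k) //= ltr_pwDl ?sumr_ge0 //.
  by have [_ _ _ ->] := yP k.
Qed.

(** Singletons are zero sets by [exposed_vertex]. Conversely, a zero set of rank 1 containing i has
    the rank of the singleton, so the vector exposing i vanishes on all of it. *)
Lemma card_vertices (R : realFieldType) D N (Y : 'M[R]_(D, N)) :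
  ((const_mx 1 : 'rV_N) <= Y)%MS -> irredundant Y^T -> #|fsets Y 1| = N.
Proof.
move=> eY Yirr; suff -> : fsets Y 1 = [set [set i] | i in 'I_N].
  by rewrite card_imset ?card_ord //; apply: set1_inj.
have rk1 i : \rank (Y *m restr_mx [set i]) = 1%N.
  have YE : Y *m restr_mx [set i] = col i Y *m delta_mx 0 i.
    apply/matrixP=> k j; rewrite mul_restr_mxE [RHS]mxE big_ord1 !mxE inE.
    by case: eqVneq => [->|]; rewrite ?mulr0.
  apply/eqP; rewrite eqn_leq; apply/andP; split.
    by rewrite YE (leq_trans (mxrankM_maxl _ _)) ?rank_leq_col.
  rewrite lt0n mxrank_eq0; have /submxP[u uE] := eY; apply/eqP=> Y0.
  have : (const_mx 1 *m restr_mx [set i] : 'rV[R]_N) 0 i = 0.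
    by rewrite uE -mulmxA Y0 mulmx0 mxE.
  by rewrite mul_restr_mxE mxE inE eqxx mulr1 => /eqP; rewrite oner_eq0.
apply/setP=> S; apply/idP/imsetP => [/fsetsP[y [yY yn SE rS]] | [i _ ->]].
  have [i iS] := fsets_gt0 rS; exists i => //.
  have [x [xY _ xi]] := exposed_vertex i eY Yirr.
  apply/eqP; rewrite eqEsubset sub1set iS andbT -xi.
  have sub1S : [set i] \subset S by rewrite sub1set.
  by apply: (vanish_superset sub1S _ xY); rewrite ?xi // rk1 rS.
have [y [yY yn yi]] := exposed_vertex i eY Yirr.
by rewrite inE; apply/asboolP; exists y; split.
Qed.

Lemma homog_const1 (R : realFieldType) N d (A : 'M[R]_(N, d)) :
  ((const_mx 1 : 'rV_N) <= homog A)%MS.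
Proof. by rewrite /homog -addsmxE addsmxSl. Qed.

Lemma homogT (R : realFieldType) N d (A : 'M[R]_(N, d)) :
  (homog A)^T = row_mx (const_mx 1) A.
Proof. by rewrite /homog tr_col_mx trmxK trmx_const. Qed.

Lemma conv_rows_homog (R : realType) N d (A : 'M[R]_(N, d)) x :
  conv_rows A x <-> exists2 w : 'rV_N, w \is a mxOver Num.nneg &
    row_mx (const_mx 1 : 'M_1) x = w *m (homog A)^T.
Proof.
have sumE (w : 'rV_N) : w *m const_mx 1 = const_mx (\sum_i w ord0 i) :> 'M[R]_1.
  by apply/matrixP=> i j; rewrite !ord1 !mxE; apply: eq_bigr => k _; rewrite mxE mulr1.
split=> [[w [wn w1 ->]] | [w wn]]; first by exists w; rewrite // homogT mul_mx_row sumE w1.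
rewrite homogT mul_mx_row sumE => /eq_row_mx[/matrixP/(_ 0 0) + ->].
by rewrite !mxE => w1; exists w.
Qed.

Lemma irredundant_rows (R : realType) N d (A : 'M[R]_(N, d)) :
  exists (N' : nat) (A' : 'M[R]_(N', d)),
    conv_rows A = conv_rows A' /\ irredundant (homog A')^T.
Proof.
elim: N A => [|N IHN] A; first by exists 0%N, A; split=> // [[]].
have [Airr | /existsNP[i /existsNP[w /not_implyP[wn /not_implyP[wi /contrapT Ai]]]]] :=
  pselect (irredundant (homog A)^T); first by exists N.+1, A.
have [N' [A' [AE A'irr]]] := IHN (row' i A); exists N', A'; split=> //.
rewrite -AE.
have rE : row' i (homog A)^T = (homog (row' i A))^T.
  by rewrite !homogT row'_row_mx row'_const.
apply/seteqP; split=> x /conv_rows_homog[v vn xE]; apply/conv_rows_homog.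
  by have [v' v'n vE] := redundant_row vn wn wi Ai; exists v'; rewrite // xE vE rE.
exists (\row_j oapp (v 0) 0 (unlift i j)).
  by apply/nnegmxP=> k j; rewrite mxE; case: unlift => //= l; apply/nnegmxP.
rewrite xE -rE; apply/rowP=> j; rewrite !mxE (bigD1_ord i) //= mxE unlift_none mul0r add0r.
by apply: eq_bigr => l _; rewrite !mxE liftK.
Qed.

(** The number of vertices, an argument of [faces], becomes the number of rows by
    [card_vertices]. *)
Lemma polytope_irredundant (R : realType) N d (P : set 'rV[R]_d) : polytope P ->
  (kfaces P 0 #= `I_N)%card ->
  exists A : 'M[R]_(N, d), P = conv_rows A /\ irredundant (homog A)^T.
Proof.
move=> [N0 [A0 ->]]; have [N' [A [-> Airr]]] := irredundant_rows A0.
move=> /card_kfaces; rewrite card_vertices ?homog_const1 // => NE.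
by move: A Airr; rewrite -NE => A Airr; exists A.
Qed.

Lemma faces_bounded (R : realType) N d k m (P : set 'rV[R]_d) :
  polytope P -> (kfaces P 0 #= `I_N)%card -> (kfaces P k #= `I_m)%card ->
  (m <= 'C(N, k.+1))%N.
Proof.
move=> pP P0; have [A [-> Airr]] := polytope_irredundant pP P0.
by move=> /card_kfaces ->; apply: card_fsets_le.
Qed.

Lemma faces_le (R : realType) N d k : (faces R N d k <= 'C(N, k.+1))%N.
Proof.
by apply: (proj1 (supremum_nat_le _)) => m [P [pP _ P0 Pm]]; apply: faces_bounded Pm.
Qed.

(** The binomial bound makes the supremum in [faces] an upper bound of its set; irredundance gives N
    vertices and the rank gives full dimension. *)
Lemma faces_ge (R : realType) N d k (A : 'M[R]_(N, d)) :
  (0 < N)%N -> irredundant (homog A)^T -> \rank (homog A) = d.+1 ->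
  (#|fsets (homog A) k.+1| <= faces R N d k)%N.
Proof.
move=> N0 Airr rA.
apply: (proj2 (supremum_nat_le (b := 'C(N, k.+1)) _)).
  by move=> m [P [pP _ P0 Pm]]; apply: faces_bounded Pm.
exists (conv_rows A); split; first by exists N, A.
- have -> : conv_rows A = hull A setT.
    by apply/seteqP; split=> x [w]; [move=> [wn w1 ->] | move=> [wn w1 _ ->]];
       exists w; split=> // i; rewrite inE.
  by apply/(hull_aff_dim _ _ (in_setT (Ordinal N0))); rewrite restr_mxT.
- by apply/card_kfaces; rewrite card_vertices ?homog_const1.
- exact/card_kfaces.
Qed.

(** * Linear Euclidean distance matrices *)

Lemma nneg_mulmx (R : numDomainType) m n p (A : 'M[R]_(m, n)) (B : 'M_(n, p)) :
  A \is a mxOver Num.nneg -> B \is a mxOver Num.nneg -> A *m B \is a mxOver Num.nneg.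
Proof.
move=> /nnegmxP A0 /nnegmxP B0; apply/nnegmxP=> i j.
by rewrite mxE sumr_ge0 // => k _; rewrite mulr_ge0.
Qed.

Lemma nneg_trmx (R : numDomainType) m n (A : 'M[R]_(m, n)) :
  A \is a mxOver Num.nneg -> A^T \is a mxOver Num.nneg.
Proof. by move=> /nnegmxP A0; apply/nnegmxP=> i j; rewrite mxE. Qed.

Lemma linear_edm_sym (R : realType) n (a : 'I_n -> R) : (linear_edm a)^T = linear_edm a.
Proof. by apply/matrixP=> i j; rewrite !mxE -sqrrN opprB. Qed.

Lemma linear_edm_nneg (R : realType) n (a : 'I_n -> R) :
  linear_edm a \is a mxOver Num.nneg.
Proof. by apply/nnegmxP=> i j; rewrite mxE sqr_ge0. Qed.

Lemma linear_edm_neq0 (R : realType) n (a : 'I_n -> R) i j :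
  injective a -> i != j -> linear_edm a i j != 0.
Proof. by move=> a_inj ij; rewrite mxE sqrf_eq0 subr_eq0 (inj_eq a_inj). Qed.

(** The symmetric 3 x 3 matrix with zero diagonal and entries p, q, s above it has determinant 2 p q
    s. *)
Lemma hollow3_injective (R : realFieldType) (b c d p q s : R) :
  p != 0 -> q != 0 -> s != 0 -> c * p + d * q = 0 -> b * p + d * s = 0 ->
  b * q + c * s = 0 -> [/\ b = 0, c = 0 & d = 0].
Proof.
move=> p0 q0 s0 e0 e1 e2.
have f0 : s * (c * p + d * q) = 0 by rewrite e0 mulr0.
have f1 : q * (b * p + d * s) = 0 by rewrite e1 mulr0.
have f2 : p * (b * q + c * s) = 0 by rewrite e2 mulr0.
split.
- by apply: (mulIf p0); apply: (mulIf q0); lra.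
- by apply: (mulIf p0); apply: (mulIf s0); lra.
- by apply: (mulIf q0); apply: (mulIf s0); lra.
Qed.

(** Expanding the square factors the matrix through dimension 3. The first three rows are
    independent, since their first three columns form a matrix as in [hollow3_injective]. *)
Lemma rank_linear_edm (R : realType) n (a : 'I_n -> R) :
  injective a -> (3 <= n)%N -> \rank (linear_edm a) = 3%N.
Proof.
move=> a_inj n3; apply/eqP; rewrite eqn_leq; apply/andP; split.
  pose L := \matrix_(i < n, k < 3) (a i ^+ k).
  pose Q := \matrix_(k < 3, j < n) [:: a j ^+ 2; - (a j) *+ 2; 1]`_k.
  have -> : linear_edm a = L *m Q.
    by apply/matrixP=> i j; rewrite !mxE !big_ord_recl big_ord0 !mxE /=; ring.
  by rewrite (leq_trans (mxrankM_maxl _ _)) ?rank_leq_col.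
pose f : 'I_3 -> 'I_n := widen_ord n3.
apply: leq_trans (mxrankS (rowsub_sub f (linear_edm a))).
have f_inj : injective f by move=> i j /(congr1 val) /= /val_inj.
have : row_free (rowsub f (linear_edm a)).
  rewrite -kermx_eq0; apply/eqP/row_matrixP=> k; set u := row k _; rewrite row0.
  pose o0 : 'I_3 := ord0; pose o1 : 'I_3 := lift ord0 ord0.
  pose o2 : 'I_3 := lift ord0 (lift ord0 ord0).
  have eqj j : u 0 o0 * (a (f o0) - a (f j)) ^+ 2 +
      (u 0 o1 * (a (f o1) - a (f j)) ^+ 2 + u 0 o2 * (a (f o2) - a (f j)) ^+ 2) = 0.
    have : u *m rowsub f (linear_edm a) = 0 by apply/sub_kermxP/row_sub.
    move=> /rowP/(_ (f j)); rewrite mxE [RHS]mxE !big_ord_recl big_ord0 addr0 => <-.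
    by do 2?congr (_ + _); congr (_ * _); rewrite mxE mxE.
  have [[e0 e1] e2] := (eqj o0, eqj o1, eqj o2).
  have dist i j : i != j -> (a (f i) - a (f j)) ^+ 2 != 0.
    by move=> ij; rewrite expf_eq0 subr_eq0 (inj_eq a_inj) (inj_eq f_inj).
  have [[d01 d02] d12] := (dist o0 o1 isT, dist o0 o2 isT, dist o1 o2 isT).
  have [|||b0 c0 d0] := @hollow3_injective _ (u 0 o0) (u 0 o1) (u 0 o2) _ _ _ d01 d02 d12.
  - by move: e0; rewrite subrr expr0n mulr0 add0r -!(sqrrN (_ - a (f o0))) !opprB.
  - by move: e1; rewrite subrr expr0n mulr0 add0r -(sqrrN (a (f o2) - _)) opprB.
  - by move: e2; rewrite subrr expr0n mulr0 addr0.
  apply/rowP=> k'; rewrite [RHS]mxE; have : k' \in [:: o0; o1; o2].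
    by rewrite !inE -!val_eqE /=; case: k' => [[|[|[|]]]].
  by rewrite !inE => /or3P[] /eqP->.
by rewrite -row_leq_rank.
Qed.

(** Column l of the product lists the values at the distinct points [a i] of a polynomial of degree
    at most 2. *)
Lemma zeros_mul_linear_edm (R : realType) n k (a : 'I_n -> R) (X : 'M_(n, k)) l :
  injective a -> (exists i, (linear_edm a *m X) i l != 0) ->
  (#|[set i | (linear_edm a *m X) i l == 0%R]| <= 2)%N.
Proof.
move=> a_inj [i0 nz].
pose p := \sum_j X j l *: ('X - (a j)%:P) ^+ 2.
have pE i : p.[a i] = (linear_edm a *m X) i l.
  rewrite horner_sum mxE; apply: eq_bigr => j _.
  by rewrite hornerZ horner_exp hornerXsubC mxE mulrC.
have p0 : p != 0 by apply: contraNneq nz => p0; rewrite -pE p0 horner0.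
have sp : (size p <= 3)%N.
  apply: leq_trans (size_sum _ _ _) _; apply/bigmax_leqP => j _.
  by rewrite (leq_trans (size_scale_leq _ _)) // size_exp_XsubC.
rewrite -ltnS (leq_trans _ sp) // cardE -(size_map a); apply: max_poly_roots => //.
  apply/allP=> _ /mapP[i + ->]; rewrite mem_enum inE => /eqP h.
  by rewrite /root pE h.
by rewrite map_inj_uniq ?enum_uniq.
Qed.

(** Equal ranks put the columns of U in the column space of M, so that a nonzero one has at most two
    zeros. The zero diagonal of M forces [U i l = 0] whenever [V l i] is nonzero. *)
Lemma restricted_size_ge (R : realType) n k (a : 'I_n -> R) (U : 'M_(n, k)) (V : 'M_(k, n)) :
  injective a -> (3 <= n)%N -> nonneg_factorization (linear_edm a) U V ->
  \rank U = \rank (linear_edm a) -> (n <= k)%N.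
Proof.
move=> a_inj n3 [/nnegmxP U0 /nnegmxP V0 ME] rU.
have [X UE] : exists X, U = linear_edm a *m X.
  have sub : ((linear_edm a)^T <= U^T)%MS by rewrite ME trmx_mul submxMl.
  have : (U^T <= (linear_edm a)^T)%MS.
    by rewrite -(geq_leqif (mxrank_leqif_sup sub)) !mxrank_tr rU.
  by case/submxP=> Z ZE; exists Z^T; rewrite -[LHS]trmxK ZE trmx_mul trmxK.
pose Z l := [set i | U i l == 0].
pose active l j := (V l j != 0) && [exists i, U i l != 0].
have UV0 i l : U i l * V l i = 0.
  have /matrixP/(_ i i)/esym/eqP := ME; rewrite mxE [X in _ == X]mxE subrr expr0n /=.
  rewrite psumr_eq0 => [/allP/(_ l)|m _]; last by rewrite mulr_ge0.
  by rewrite mem_index_enum => /(_ isT)/eqP.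
have activeZ l j : active l j -> j \in Z l.
  by move=> /andP[Vlj _]; have /eqP := UV0 j l; rewrite mulf_eq0 (negPf Vlj) orbF inE.
have meet i j : i != j -> exists2 l, active l j & U i l != 0.
  move=> ij; have : \sum_l U i l * V l j != 0.
    by have := linear_edm_neq0 a_inj ij; rewrite {1}ME mxE.
  move=> nz; have /existsP[l] : [exists l, U i l * V l j != 0].
    by apply: contraNT nz => /existsPn h; rewrite big1 // => l _; apply/eqP/negPn/h.
  rewrite mulf_eq0 negb_or => /andP[Uil Vlj]; exists l => //.
  by rewrite /active Vlj; apply/existsP; exists i.
(* Column l of U can serve column j of M only if U j l = 0.  It gets a total weight
   of at most 2 since it has at most two zeros, while each j needs either a
   column with no other zero or two columns. *)
pose w l j : nat := if active l j then (if #|Z l| == 1%N then 2 else 1)%N else 0%N.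
have wl l : (\sum_j w l j <= 2)%N.
  have [/existsP[i Uil] | /negPf noact] := boolP [exists i, U i l != 0]; last first.
    by rewrite big1 // => j _; rewrite /w /active noact andbF.
  have Z2 : (#|Z l| <= 2)%N.
    by rewrite /Z UE; apply: zeros_mul_linear_edm => //; exists i; rewrite -UE.
  apply: (@leq_trans (\sum_(j in Z l) if #|Z l| == 1 then 2 else 1)%N).
    rewrite [leqRHS]big_mkcond; apply: leq_sum => j _; rewrite /w.
    by case: ifP => // /activeZ->.
  by rewrite sum_nat_const; case: eqP => [->//|_]; rewrite muln1.
have wj j : (2 <= \sum_l w l j)%N.
  have [i ij] : exists i, i != j.
    pose x : 'I_n := Ordinal (ltn_trans (isT : 0 < 2)%N n3).
    pose y : 'I_n := Ordinal (ltn_trans (isT : 1 < 2)%N n3).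
    by have [xj | xj] := eqVneq x j; [exists y; rewrite -xj | exists x].
  have [l lj Uil] := meet i j ij.
  rewrite (bigD1 l) //= {1}/w lj; have [_|Z1] := eqVneq #|Z l| 1%N; first exact: leq_addr.
  (* Column l of U is zero at j', so the nonzero entry of M at j', j needs another column active at
     j. *)
  have [j' j'Z j'j] : exists2 j', j' \in Z l & j' != j.
    have : (1 < #|Z l|)%N.
      rewrite ltn_neqAle eq_sym Z1 /=; apply/card_gt0P; exists j; exact: activeZ.
    by move=> /card_gt1P[x [y [xZ yZ xy]]]; have [xj|] := eqVneq x j;
      [exists y; rewrite // -xj eq_sym | exists x].
  have [l' l'j Uj'l'] := meet j' j j'j.
  have l'l : l' != l by apply: contraNneq Uj'l' => ->; move: j'Z; rewrite inE.
  rewrite (bigD1 l') //= {1}/w l'j.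
  by case: ifP; lia.
have : (\sum_(j < n) 2 <= \sum_(l < k) 2)%N.
  apply: (@leq_trans (\sum_j \sum_l w l j)); first exact: leq_sum.
  by rewrite exchange_big /=; apply: leq_sum.
by rewrite !sum_nat_const !card_ord; lia.
Qed.

Lemma edm_self_factorization (R : realType) n (a : 'I_n -> R) :
  nonneg_factorization (linear_edm a) (linear_edm a) 1%:M.
Proof.
split; rewrite ?mulmx1 ?linear_edm_nneg //.
by apply/nnegmxP=> i j; rewrite mxE ler0n.
Qed.

Lemma rank_plus_starE (R : realType) n (a : 'I_n -> R) :
  injective a -> (3 <= n)%N -> rank_plus_star (linear_edm a) = n.
Proof.
move=> a_inj n3.
have [] := @infimum_nat [set k : nat | exists (U : 'M[R]_(n, k)) (V : 'M[R]_(k, n)),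
    nonneg_factorization (linear_edm a) U V /\ \rank U = \rank (linear_edm a)]%classic n.
  by exists (linear_edm a), 1%:M; split=> //; apply: edm_self_factorization.
move=> [U [V [UV rU]]] le_n; apply/eqP; rewrite eqn_leq le_n /=.
exact: restricted_size_ge UV rU.
Qed.

(** * From nonnegative factorizations to polytopes *)

Lemma eqmx_fsets (R : realFieldType) D1 D2 N (Y : 'M[R]_(D1, N)) (Y' : 'M_(D2, N)) k :
  (Y :=: Y')%MS -> fsets Y k = fsets Y' k.
Proof.
move=> eqY; apply/setP=> S; rewrite !inE; apply: asbool_equiv_eq.
by split=> -[y [yY yn SE rS]]; exists y;
  rewrite ?eqY ?(eqmxMr _ eqY) // -?eqY -?(eqmxMr _ eqY).
Qed.

Lemma irredundant_sub (R : realFieldType) D1 D2 N (U : 'M[R]_(D1, N)) (Y : 'M_(D2, N)) :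
  (U <= Y)%MS -> irredundant U^T -> irredundant Y^T.
Proof.
move=> /submxP[X UE] Uirr i w wn wi rowE; apply: (Uirr i w wn wi).
by rewrite UE trmx_mul row_mul rowE mulmxA.
Qed.

(** A basis of a complement of the constants in the row space of U gives d coordinate functions, in
    which the columns of U become points spanning the whole space affinely. *)
Lemma homog_coordinates (R : realFieldType) n N d (U : 'M[R]_(n, N)) :
  (0 < N)%N -> ((const_mx 1 : 'rV_N) <= U)%MS -> \rank U = d.+1 ->
  exists A : 'M[R]_(N, d), (homog A :=: U)%MS.
Proof.
move=> N0 eU rU; set e : 'rV[R]_N := const_mx 1 in eU.
have enz : e != 0.
  by apply/eqP=> /rowP/(_ (Ordinal N0)); rewrite !mxE => /eqP; rewrite oner_eq0.
have capE : (U :&: e :=: e)%MS by apply/capmx_idPr.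
pose G := (U :\: e)%MS.
have rG : \rank G = d.
  have := mxrank_cap_compl U e; rewrite -/G capE rU rank_rV enz /=; lia.
have UE : (e + row_base G :=: U)%MS.
  apply/eqmxP; rewrite addsmx_sub eU eq_row_base diffmxSl /=.
  by rewrite -(addsmx_diff_cap_eq U e) addsmx_sub capE addsmxSl andbT
    (submx_trans _ (addsmxSr _ _)) ?eq_row_base.
move: (row_base G) UE; rewrite rG => B UE; exists B^T.
by rewrite /homog trmxK; apply: eqmx_trans UE; apply: eqmx_sym; apply: addsmxE.
Qed.

(** A redundant column of U could be dropped by [redundant_row], contradicting minimality. *)
Lemma minimal_irredundant (R : realType) m n N (M : 'M[R]_(m, n)) (U : 'M_(m, N)) V :
  nonneg_factorization M U V -> rank_plus M = N -> irredundant U^T.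
Proof.
case: N U V => [|N] U V [U0 V0 ME] rM i w wn wi Ui; first by case: i wi {Ui}.
have [W Wn WE] := redundant_row (nneg_trmx V0) wn wi Ui.
have : [set k : nat | exists (U : 'M[R]_(m, k)) (V : 'M[R]_(k, n)),
    nonneg_factorization M U V]%classic N.
  exists (col' i U), W^T; split.
  - by apply/nnegmxP=> k l; rewrite mxE; apply/nnegmxP.
  - exact: nneg_trmx.
  - apply: trmx_inj; rewrite ME trmx_mul WE trmx_mul trmxK; congr (_ *m _).
    by apply/matrixP=> k l; rewrite !mxE.
by move=> /infimum_nat[_]; rewrite -[infimum _ _]/(rank_plus M) rM ltnn.
Qed.

(** Columns are scaled to sum 1, so that the rows of U' add up to the constant vector. No column sum
    is zero, as a zero column would be redundant. *)
Lemma normalize_factorization (R : realType) m n N (M : 'M[R]_(m, n)) (U : 'M_(m, N)) V :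
  nonneg_factorization M U V -> irredundant U^T ->
  exists (U' : 'M_(m, N)) V', [/\ nonneg_factorization M U' V',
    \rank U' = \rank U & ((const_mx 1 : 'rV_N) <= U')%MS].
Proof.
move=> [/nnegmxP U0 /nnegmxP V0 ME] Uirr.
pose s k := \sum_i U i k.
have s0 k : 0 < s k.
  rewrite lt_neqAle eq_sym sumr_ge0 // andbT; apply/eqP => sk.
  apply: (Uirr k 0); rewrite ?mxE //; first by apply/nnegmxP=> i j; rewrite mxE.
  rewrite mul0mx; apply/rowP=> i; rewrite !mxE; apply/eqP.
  have : s k == 0 by apply/eqP.
  by rewrite psumr_eq0 // => /allP/(_ i); rewrite mem_index_enum; apply.
have sn k : s k != 0 by rewrite gt_eqF.
pose Dg : 'M_N := diag_mx (\row_k s k); pose Di : 'M_N := diag_mx (\row_k (s k)^-1).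
have DiD : Di *m Dg = 1%:M.
  by apply/matrixP=> i j; rewrite mul_diag_mx !mxE mulrnAr mulVf.
have Diu : Di \in unitmx by case: (mulmx1_unit DiD).
exists (U *m Di), (Dg *m V); split.
- split.
  + by apply/nnegmxP=> i j; rewrite mul_mx_diag !mxE mulr_ge0 // invr_ge0 ltW.
  + by apply/nnegmxP=> i j; rewrite mul_diag_mx !mxE mulr_ge0 // ltW.
  + by rewrite mulmxA -(mulmxA U) DiD mulmx1.
- by rewrite mxrankMfree // row_free_unit.
- apply/submxP; exists (const_mx 1); apply/rowP=> k; rewrite mulmxA mul_mx_diag !mxE.
  under eq_bigr do rewrite mxE mul1r.
  by rewrite -/(s k) divff.
Qed.

(** The strict bound places the rank of U in the range of the maximum. If U has full column rank,
    then [rank_plus] is n and the factorization of M as M times 1 has rank 3 < n; this is where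
    [4 <= n] enters. *)
Lemma linear_edm_low_rank_factorization (R : realType) n (a : 'I_n -> R) :
  injective a -> (4 <= n)%N ->
  exists (U : 'M_(n, rank_plus (linear_edm a))) V,
    nonneg_factorization (linear_edm a) U V /\
    (3 <= \rank U < rank_plus (linear_edm a))%N.
Proof.
move=> a_inj n4; have n3 := ltnW n4; have r3 := rank_linear_edm a_inj n3.
set rp := rank_plus _.
have [[U [V UV]] le_rp] : [set k : nat | exists (U : 'M[R]_(n, k)) (V : 'M[R]_(k, n)),
    nonneg_factorization (linear_edm a) U V]%classic rp /\ (rp <= n)%N.
  apply: infimum_nat; exists (linear_edm a), 1%:M; exact: edm_self_factorization.
have [Un Vn ME] := UV.
have rU : (3 <= \rank U)%N by rewrite -r3 ME mxrankM_maxl.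
have [lt_rU | ge_rU] := ltnP (\rank U) rp; first by exists U, V; rewrite rU.
have rpn : rp = n.
  apply/eqP; rewrite eqn_leq le_rp /=.
  apply: (@restricted_size_ge _ _ _ a V^T U^T) => //.
    split; rewrite ?nneg_trmx //.
    by rewrite -trmx_mul -ME linear_edm_sym.
  rewrite -[in RHS]linear_edm_sym ME trmx_mul mxrankMfree //.
  by rewrite -row_leq_rank mxrank_tr.
rewrite rpn; exists (linear_edm a), 1%:M; split; first exact: edm_self_factorization.
by rewrite r3.
Qed.

(** The rows of E lie in the row space of U, so those of [E *m V] lie in that of M, which gives
    [E *m V] the rank of M. *)
Lemma size_le_card_facets (R : realType) n N D p (a : 'I_n -> R) (U : 'M_(n, N)) V
    (Y : 'M_(D, N)) :
  injective a -> (3 <= n)%N -> nonneg_factorization (linear_edm a) U V ->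
  (Y :=: U)%MS -> \rank Y = p.+1 -> (n <= #|fsets Y p|)%N.
Proof.
move=> a_inj n3 [Un Vn ME] YU rY.
have [|L [E [Ln En EY UE]]] := ray_factorization rY _ Un; first by rewrite YU.
have ME' : linear_edm a = L *m (E *m V) by rewrite mulmxA -UE.
apply: (@restricted_size_ge _ _ _ a (E *m V)^T L^T) => //.
  split; rewrite ?nneg_trmx ?nneg_mulmx //.
  by rewrite -trmx_mul -ME' linear_edm_sym.
rewrite mxrank_tr; apply/eqP; rewrite eqn_leq {2}ME' mxrankM_maxr andbT.
by apply: mxrankS; rewrite ME submxMr // -YU.
Qed.

Lemma linear_edm_faces (R : realType) n (a : 'I_n -> R) :
  injective a -> (4 <= n)%N ->
  exists2 ru, (3 <= ru < rank_plus (linear_edm a))%N &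
    (n <= minn (faces R (rank_plus (linear_edm a)) (ru - 1) (ru - 3))
               (faces R (rank_plus (linear_edm a)) (ru - 1) (ru - 3 + 1)))%N.
Proof.
move=> a_inj n4; have n3 := ltnW n4.
have [U0 [V0 [UV0 rU0]]] := linear_edm_low_rank_factorization a_inj n4.
have U0irr := minimal_irredundant UV0 erefl.
have [U [V [UV rU eU]]] := normalize_factorization UV0 U0irr.
have Uirr := minimal_irredundant UV erefl.
move: rU0; rewrite -rU; exists (\rank U) => //.
set rp := rank_plus _ in U V UV rU eU Uirr rU0 *.
have [p p0 rUp] : exists2 p, (0 < p)%N & \rank U = p.+2.
  by exists (\rank U - 2)%N; lia.
have N0 : (0 < rp)%N by lia.
have [A AU] := homog_coordinates N0 eU rUp.
have Airr : irredundant (homog A)^T by apply: irredundant_sub Uirr; rewrite AU.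
have rA : \rank (homog A) = p.+2 by rewrite AU.
have nF := size_le_card_facets a_inj n3 UV AU rA.
have e0 i : 0 < (const_mx 1 : 'rV[R]_rp) 0 i by rewrite mxE ltr01.
have FR := card_facets_le_ridges p0 rA (homog_const1 A) e0.
rewrite rUp.
(* The polytope has dimension p + 1, its facets p and its ridges p - 1: the first term of the
   minimum counts ridges and the second facets. *)
have [-> -> ->] : [/\ p.+2 - 1 = p.+1, p.+2 - 3 + 1 = p & p.+2 - 3 = p.-1]%N.
  by split; lia.
rewrite leq_min; apply/andP; split.
  by apply: leq_trans (faces_ge _ N0 Airr rA); rewrite prednK // (leq_trans nF).
by apply: leq_trans (faces_ge _ N0 Airr rA).
Qed.

End Development.

Theorem corollary5 (R : realType) (n : nat) (a : 'I_n -> R) :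
  injective a -> 3 <= n ->
  let M := linear_edm a in
  let r := (\rank M)%N in
  let rp := rank_plus M in
  r = 3 /\
  rank_plus_star M = n /\
  (4 <= n ->
    n <= \max_(3 <= ru < rp)
           minn (faces R rp (ru - 1) (ru - r)) (faces R rp (ru - 1) (ru - r + 1))) /\
  \max_(3 <= ru < rp)
     minn (faces R rp (ru - 1) (ru - r)) (faces R rp (ru - 1) (ru - r + 1))
    <= \max_(3 <= ru < rp) faces R rp (ru - 1) (ru - r) /\
  \max_(3 <= ru < rp) faces R rp (ru - 1) (ru - r) = phi' R r rp /\
  phi' R r rp <= 'C(rp, rp./2) /\
  'C(rp, rp./2) <= 2 ^ rp.
Proof.
move=> a_inj n3 M r rp.
have r3 : r = 3 by apply: rank_linear_edm.
rewrite r3; split=> //; split; first exact: rank_plus_starE.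
split=> [n4|].
  have [ru ru_bd le_n] := linear_edm_faces a_inj n4; apply: leq_trans le_n _.
  by apply: (@leq_bigmax_seq _ _ xpredT (fun ru => minn (faces R rp (ru - 1) (ru - 3))
    (faces R rp (ru - 1) (ru - 3 + 1)))); rewrite // mem_index_iota.
split.
  apply/bigmax_leqP_seq=> ru ru_in _; apply: leq_trans (geq_minl _ _) _.
  exact: (@leq_bigmax_seq _ _ xpredT (fun ru => faces R rp (ru - 1) (ru - 3))).
split=> //; split; last exact: bin_le_exp2.
by apply/bigmax_leqP_seq=> ru _ _; apply: leq_trans (faces_le _ _ _ _) (bin_le_half _ _).
Qed.
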